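(* Let $d\geq 1$ and let $\mathcal{L}_i\in K^{d\times d}$ ($i\geq 0$) be as defined in the context. Then the ordered infinite product $$\prod_{i\geq 0}^{\longleftarrow}\big(1-\mathcal{L}_i\tau\big):=\lim_{k\to\infty}(1-\mathcal{L}_{k-1}\tau)(1-\mathcal{L}_{k-2}\tau)\cdots(1-\mathcal{L}_{0}\tau)$$ converges coefficientwise (i.e. for each $j\geq 0$ the coefficient of $\tau^j$ of the partial products converges in $K_\infty^{d\times d}$), and $$\sin_A^{\otimes d}=\prod_{i\geq 0}^{\longleftarrow}\big(1-\mathcal{L}_i\tau\big)\quad\text{in } K_\infty^{d\times d}[[\tau]].$$
   Context: Let $\mathbb{F}_q$ be a finite field with $q$ elements and characteristic $p$, $A=\mathbb{F}_q[\theta]$, $K=\mathbb{F}_q(\theta)$, $K_\infty=\mathbb{F}_q((1/\theta))$ with absolute value $|\cdot|$ normalized by $|\theta|>1$, and $\mathbb{C}_\infty$ the completion of an algebraic closure of $K_\infty$. For $c\in\mathbb{C}_\infty$ put $c^{(k)}=c^{q^k}$, and for a matrix $M$ let $M^{(k)}$ be obtained by applying this entrywise. For a subring $R\subseteq\mathbb{C}_\infty$, $R^{d\times d}[[\tau]]$ denotes the ring of formal series $\sum_{i\geq0}M_i\tau^i$ ($M_i\in R^{d\times d}$) with multiplication determined by $\tau M=M^{(1)}\tau$; such a series acts on column vectors $Z\in\mathbb{C}_\infty^{d}$ by $Z\mapsto\sum_i M_iZ^{(i)}$ when this converges. Fix $d\geq1$; let $e_{i,j}$ be the elementary $d\times d$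 matrix and $N=\sum_{i=1}^{d-1}e_{i,i+1}$. Define $C^{\otimes d}_\theta=\theta\cdot 1+N+e_{d,1}\tau\in K^{d\times d}[\tau]$. There is a unique series $\exp_{C^{\otimes d}}=\sum_{i\ge0}Q_i\tau^i\in K^{d\times d}[[\tau]]$ with $Q_0=1$ and $\exp_{C^{\otimes d}}(\theta+N)=C^{\otimes d}_\theta\exp_{C^{\otimes d}}$; it defines an entire surjective $\mathbb{F}_q$-linear map $\mathbb{C}_\infty^d\to\mathbb{C}_\infty^d$ whose kernel is $\{a(\theta+N)\Pi:a\in A\}$ for some nonzero $\Pi=(\pi_{d-1},\dots,\pi_1,\pi_0)^\top\in\mathbb{C}_\infty^{d}$ (Anderson–Thakur). Put $\widehat{\Pi}$ the upper triangular matrix with $(i,j)$-entry $\pi_{j-i}$ for $j\geq i$ and $0$ otherwise, and $\sin_A^{\otimes d}:=\widehat{\Pi}^{-1}\exp_{C^{\otimes d}}\widehat{\Pi}$ (independent of the choice of $\Pi$). Hyperderivatives: for a field $F$ and indeterminate $x$, $(\mathcal{D}_{x,j})_{j\ge0}$ is the family of Hasse–Schmidt derivatives on $F(x)$, determined by $\mathcal{D}_{x,j}(x^i)=\binom{i}{j}x^{i-j}$; with several indeterminates, $\mathcal{D}_{x,j}$ treats the others as constants. For $f\in F(x,z)$ (possibly depending on further indeterminates treated as constants) let $\boldsymbol{\Delta}_{x,z}(f)$ be the $d\times d$ matrix with $(i,j)$-entry $\mathcal{D}_{x,d-i}(\mathcal{D}_{z,j-1}(f))$, $1\le i,j\le d$.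 Let $f_d(x,y,z)=\sum_{j=0}^{d-1}(z-y)^j(x-y)^{d-1-j}$ (with coefficients reduced mod $p$). For $i\geq0$ set $$\mathcal{L}_i:=\boldsymbol{\Delta}_{x,z}\left(f_d(x,y,z)\Big(\frac{(x-\theta^q)\cdots(x-\theta^{q^i})}{(z-\theta^{q^2})\cdots(z-\theta^{q^{i+1}})}\Big)^d\right)\Bigg|_{x=\theta,\ y=\theta^{q^{i+1}},\ z=\theta^q}\in K^{d\times d}$$ (empty products equal $1$). *)

(* Defs.v *)
From HB Require Import structures.
From mathcomp Require Import all_boot all_order all_algebra fraction generic_quotient.
From mathcomp Require Import all_classical all_reals all_analysis.

Set Implicit Arguments.
Unset Strict Implicit.
Unset Printing Implicit Defensive.

Import Order.TTheory GRing.Theory Num.Theory.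
Import numFieldNormedType.Exports.
Local Open Scope ring_scope.

Notation "x %:F" := (@FracField.tofrac _ x) : ring_scope.

Definition hasse_schmidt (B : comNzRingType) (D : nat -> B -> B) : Prop :=
  [/\ forall a, D 0%N a = a,
      forall j a b, D j (a + b) = D j a + D j b
    & forall j a b, D j (a * b) = \sum_(k < j.+1) D k a * D (j - k)%N b].

Definition frac_num (B : idomainType) (f : {fraction B}) : B := (frac (repr f)).1.
Definition frac_den (B : idomainType) (f : {fraction B}) : B := (frac (repr f)).2.

(* [hasse_frac D j f] is the j-th term of the extension to the fraction field of
   the Hasse-Schmidt family [D] on [B]. Writing [f = n / m], the Leibniz rule for
   [n = f * m] forces
     [D_j f = (D_j n - \sum_(k < j) D_k f * D_(j - k) m) / m];
   [hasse_frac_seq D f j] lists [D_0 f, ..., D_(j-1) f]. See [hasse_frac_uniq]. *)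
Fixpoint hasse_frac_seq (B : idomainType) (D : nat -> B -> B) (f : {fraction B})
    (j : nat) : seq {fraction B} :=
  if j is i.+1 then
    let s := hasse_frac_seq D f i in
    rcons s (((D i (frac_num f))%:F
              - \sum_(k < i) s`_k * (D (i - k)%N (frac_den f))%:F)
             / (frac_den f)%:F)
  else [::].

Definition hasse_frac (B : idomainType) (D : nat -> B -> B) (j : nat)
    (f : {fraction B}) : {fraction B} :=
  (hasse_frac_seq D f j.+1)`_j.

Section HasseFracTheory.
Variable B : idomainType.
Implicit Types (f g : {fraction B}) (a b : B).

Lemma frac_den_neq0 f : frac_den f != 0.
Proof. exact: denom_ratioP. Qed.

Lemma frac_numdenE f : f = (frac_num f)%:F / (frac_den f)%:F.
Proof.
have d0 : (frac_den f)%:F != 0 :> {fraction B} by rewrite tofrac_eq0 frac_den_neq0.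
apply: (mulIf d0); rewrite divfK //.
rewrite /frac_num /frac_den -[X in X * _]reprK; set r := repr f.
unlock FracField.tofrac; rewrite -[LHS]FracField.pi_mul; apply/eqP.
rewrite FracField.equivf_def /FracField.mulf.
have e1 x : (Ratio x 1).1 = x by rewrite numer_Ratio ?oner_neq0.
have e2 (x : B) : (Ratio x 1).2 = 1 by rewrite denom_Ratio ?oner_neq0.
by rewrite !e1 !e2 !mulr1 !numden_Ratio ?denom_ratioP // mulrC.
Qed.

Section Convolution.
Variable L : fieldType.
Implicit Types u v w : nat -> L.

Definition conv u v n := \sum_(k < n.+1) u k * v (n - k)%N.

Let P n u := \poly_(i < n.+1) u i.

Lemma conv_poly n m u v : (m <= n)%N -> conv u v m = (P n u * P n v)`_m.
Proof.
move=> le_mn; rewrite coefM; apply: eq_bigr => k _.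
rewrite !coef_poly !ltnS (leq_trans (leq_subr _ _) le_mn).
by rewrite (leq_trans _ le_mn) // -ltnS.
Qed.

Lemma convC u v n : conv u v n = conv v u n.
Proof. by rewrite !(@conv_poly n n) // mulrC. Qed.

Lemma convA u v w n : conv u (conv v w) n = conv (conv u v) w n.
Proof.
have := congr1 (fun p : {poly L} => p`_n) (mulrA (P n u) (P n v) (P n w)).
rewrite /= coefM [in RHS]coefM => e.
rewrite [LHS](_ : _ = \sum_(j < n.+1) (P n u)`_j * (P n v * P n w)`_(n - j)).
  rewrite e; apply: eq_bigr => k _.
  have lk : (k <= n)%N by rewrite -ltnS.
  rewrite -(conv_poly _ _ lk).
  by rewrite coef_poly ltnS leq_subr.
by apply: eq_bigr => k _; rewrite -conv_poly ?leq_subr // coef_poly ltn_ord.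
Qed.

Lemma conv_cancel u v w : w 0%N != 0 ->
  conv u w =1 conv v w -> u =1 v.
Proof.
move=> w0 e n; elim/ltn_ind: n => n IH.
have := e n; rewrite /conv !big_ord_recr /= subnn.
rewrite (eq_bigr (fun k : 'I_n => v k * w (n - k)%N)) => [|k _]; last by rewrite IH.
by move/addrI/(mulIf w0).
Qed.

End Convolution.

Variable D : nat -> B -> B.

Lemma size_hasse_frac_seq f j : size (hasse_frac_seq D f j) = j.
Proof. by elim: j => //= j IH; rewrite size_rcons IH. Qed.

Lemma nth_hasse_frac_seq f j k : (k < j)%N ->
  (hasse_frac_seq D f j)`_k = hasse_frac D k f.
Proof.
elim: j => // j IH; rewrite ltnS leq_eqVlt => /predU1P[->//|lt_kj].
by rewrite /= nth_rcons size_hasse_frac_seq lt_kj IH.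
Qed.

Lemma hasse_frac_rec f j :
  \sum_(k < j.+1) hasse_frac D k f * (D (j - k)%N (frac_den f))%:F
    = (D j (frac_num f))%:F
      + hasse_frac D j f * ((D 0%N (frac_den f))%:F - (frac_den f)%:F).
Proof.
have d0 : (frac_den f)%:F != 0 :> {fraction B} by rewrite tofrac_eq0 frac_den_neq0.
have hj : hasse_frac D j f * (frac_den f)%:F = (D j (frac_num f))%:F
    - \sum_(k < j) hasse_frac D k f * (D (j - k)%N (frac_den f))%:F.
  rewrite [X in X * _]/hasse_frac /= nth_rcons size_hasse_frac_seq ltnn eqxx divfK //.
  by congr (_ - _); apply: eq_bigr => k _; rewrite nth_hasse_frac_seq.
by rewrite big_ord_recr /= subnn mulrBr hj opprB [RHS]addrC -addrA subrK addrC.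
Qed.

Hypothesis HD : hasse_schmidt D.

Let T a : nat -> {fraction B} := fun j => (D j a)%:F.

Let TM a b j : T (a * b) j = conv (T a) (T b) j.
Proof.
case: HD => _ _ HM; rewrite /T HM rmorph_sum /=.
by apply: eq_bigr => k _; rewrite rmorphM.
Qed.

Let T0 a : T a 0%N = a%:F. Proof. by case: HD => H0 _ _; rewrite /T H0. Qed.

Let cv f := conv ((hasse_frac D)^~ f).

Let cv_den f j : cv f (T (frac_den f)) j = T (frac_num f) j.
Proof.
case: HD => H0 _ _; have := hasse_frac_rec f j.
by rewrite H0 subrr mulr0 addr0.
Qed.

Lemma hasse_frac_mulE f a b : b != 0 -> f = a%:F / b%:F ->
  forall j, \sum_(k < j.+1) hasse_frac D k f * (D (j - k)%N b)%:F = (D j a)%:F.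
Proof.
move=> b0 fE; rewrite -/(T a); change (cv f (T b) =1 T a).
apply: (@conv_cancel _ _ _ (T (frac_den f))).
  by rewrite T0 tofrac_eq0 frac_den_neq0.
have e : a * frac_den f = frac_num f * b.
  have b0' : b%:F != 0 :> {fraction B} by rewrite tofrac_eq0.
  have m0 : (frac_den f)%:F != 0 :> {fraction B} by rewrite tofrac_eq0 frac_den_neq0.
  apply/eqP; rewrite -tofrac_eq !tofracM -eqr_div //; apply/eqP.
  by rewrite -frac_numdenE.
move=> j; rewrite -TM e TM -convA.
set h := hasse_frac D ^~ f.
have -> : conv h (conv (T b) (T (frac_den f))) j
        = conv h (conv (T (frac_den f)) (T b)) j.
  by apply: eq_bigr => k _; rewrite convC.
rewrite convA; apply: eq_bigr => k _; congr (_ * _); exact: cv_den.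
Qed.

Lemma hasse_frac_tofrac j a : hasse_frac D j a%:F = (D j a)%:F.
Proof.
have e : a%:F = a%:F / 1%:F :> {fraction B} by rewrite tofrac1 divr1.
have H1 : hasse_frac D ^~ a%:F =1 T a; last exact: H1.
apply: (@conv_cancel _ _ _ (T 1)); first by rewrite T0 tofrac1 oner_neq0.
by move=> n; rewrite [LHS](hasse_frac_mulE (oner_neq0 B) e n) -TM mulr1.
Qed.

Lemma hasse_frac_uniq (E : nat -> {fraction B} -> {fraction B}) :
  hasse_schmidt E -> (forall j a, E j a%:F = (D j a)%:F) ->
  forall j f, E j f = hasse_frac D j f.
Proof.
case=> _ _ EM Ea j f; move: j.
apply: (@conv_cancel _ (E^~ f) ((hasse_frac D)^~ f) (T (frac_den f))).
  by rewrite T0 tofrac_eq0 frac_den_neq0.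
move=> j; rewrite [RHS]cv_den /T -Ea.
have -> : (frac_num f)%:F = f * (frac_den f)%:F.
  by rewrite {2}[f]frac_numdenE divfK // tofrac_eq0 frac_den_neq0.
by rewrite EM; apply: eq_bigr => k _; rewrite Ea.
Qed.

Lemma hasse_frac_hasse_schmidt : hasse_schmidt (hasse_frac D).
Proof.
have TD a b j : T (a + b) j = T a j + T b j.
  by case: HD => _ HA _; rewrite /T HA rmorphD.
have den0 f : T (frac_den f) 0%N != 0 by rewrite T0 tofrac_eq0 frac_den_neq0.
have dF0 f : (frac_den f)%:F != 0 :> {fraction B} by rewrite tofrac_eq0 frac_den_neq0.
have m0 f g : frac_den f * frac_den g != 0 by rewrite mulf_neq0 ?frac_den_neq0.
split.
- move=> f; apply: (mulIf (den0 f)).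
  have := cv_den f 0%N; rewrite /cv /conv big_ord1 subn0 => ->.
  by rewrite !T0 {2}[f]frac_numdenE divfK.
- move=> j f g; move: j.
  set m := frac_den f * frac_den g.
  have eD : f + g
      = (frac_num f * frac_den g + frac_num g * frac_den f)%:F / m%:F.
    by rewrite tofracM tofracD !tofracM -addf_div // -!frac_numdenE.
  have ef : f = (frac_num f * frac_den g)%:F / m%:F.
    by rewrite !tofracM -mulf_div divff ?mulr1 // -frac_numdenE.
  have eg : g = (frac_num g * frac_den f)%:F / m%:F.
    by rewrite /m [_ * frac_den g]mulrC !tofracM -mulf_div divff ?mulr1 // -frac_numdenE.
  apply: (@conv_cancel _ _ _ (T m)); first by rewrite T0 tofrac_eq0 m0.
  move=> j; rewrite [LHS](hasse_frac_mulE (m0 f g) eD).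
  rewrite [LHS]TD /T -(hasse_frac_mulE (m0 f g) ef) -(hasse_frac_mulE (m0 f g) eg).
  by rewrite -big_split; apply: eq_bigr => k _; rewrite mulrDl.
- move=> j f g; move: j.
  have eM : f * g = (frac_num f * frac_num g)%:F / (frac_den f * frac_den g)%:F.
    by rewrite !tofracM -mulf_div -!frac_numdenE.
  apply: (@conv_cancel _ _ (conv (hasse_frac D ^~ f) (hasse_frac D ^~ g))
            (T (frac_den f * frac_den g))); first by rewrite T0 tofrac_eq0 m0.
  move=> j; rewrite [LHS](hasse_frac_mulE (m0 f g) eM) -/(T _ j) TM.
  set A := hasse_frac D ^~ f; set G := hasse_frac D ^~ g.
  have -> : conv (conv A G) (T (frac_den f * frac_den g)) j
          = conv (conv A G) (conv (T (frac_den f)) (T (frac_den g))) j.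
    by apply: eq_bigr => k _; rewrite TM.
  rewrite convA.
  have -> : conv (conv (conv A G) (T (frac_den f))) (T (frac_den g)) j
          = conv (conv (T (frac_num f)) G) (T (frac_den g)) j.
    apply: eq_bigr => k _; congr (_ * _).
    rewrite -convA.
    have -> : conv A (conv G (T (frac_den f))) k = conv A (conv (T (frac_den f)) G) k.
      by apply: eq_bigr => l _; rewrite convC.
    by rewrite convA; apply: eq_bigr => l _; congr (_ * _); rewrite -cv_den.
  by rewrite -convA; apply: eq_bigr => k _; congr (_ * _); rewrite -cv_den.
Qed.

End HasseFracTheory.

(* E[y][z][x] : the outermost variable is x and the innermost one is y. *)
Notation poly3 E := {poly {poly {poly E}}}.
Notation ratfun3 E := {fraction {poly {poly {poly E}}}}.

Section RatFun3.
Variable E : fieldType.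

Definition rf_cst (c : E) : ratfun3 E := ((c%:P%:P%:P : poly3 E)%:F).
Definition rf_x : ratfun3 E := ('X : poly3 E)%:F.
Definition rf_z : ratfun3 E := ('X%:P : poly3 E)%:F.
Definition rf_y : ratfun3 E := ('X%:P%:P : poly3 E)%:F.

Definition hasse_x : nat -> ratfun3 E -> ratfun3 E :=
  hasse_frac (fun j (p : poly3 E) => p^`N(j)).
Definition hasse_z : nat -> ratfun3 E -> ratfun3 E :=
  hasse_frac (fun j (p : poly3 E) => map_poly (fun c => c^`N(j)) p).

Definition poly3_eval (x y z : E) (p : poly3 E) : E := p.[x%:P%:P].[z%:P].[y].

(* The value of [f] at (x, y, z) is [a(x,y,z) / b(x,y,z)] for any presentation
   [f = a / b] whose denominator does not vanish at that point (see
   [ratfun3_evalE]); it is 0 by convention if there is none. *)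
Definition ratfun3_eval (x y z : E) (f : ratfun3 E) : E :=
  xget 0 [set v | exists a b : poly3 E,
    [/\ poly3_eval x y z b != 0, f = a%:F / b%:F
      & v = poly3_eval x y z a / poly3_eval x y z b]]%classic.

(* Delta_{x,z}(f); the mathematical indices are [i.+1] and [j.+1]. *)
Definition Delta (d : nat) (f : ratfun3 E) : 'M[ratfun3 E]_d :=
  \matrix_(i < d, j < d) hasse_x (d - i.+1)%N (hasse_z j f).

Definition f_poly (d : nat) (x y z : ratfun3 E) : ratfun3 E :=
  \sum_(j < d) (z - y) ^+ j * (x - y) ^+ (d - 1 - j)%N.

Lemma nderivn_hasse_schmidt (A : comNzRingType) :
  hasse_schmidt (fun j (p : {poly A}) => p^`N(j)).
Proof.
split=> [p|j p q|j p q]; first exact: nderivn0.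
  exact: nderivnD.
elim/poly_ind: p j => [|p c IH] j.
  by rewrite mul0r raddf0 big1 // => k _; rewrite raddf0 mul0r.
have dMX (r : {poly A}) i : (r * 'X)^`N(i) = r^`N(i) * 'X + (if i is k.+1 then r^`N(k) else 0).
  case: i => [|i]; first by rewrite !nderivn0 addr0.
  by have := nderivnMXaddC i r 0; rewrite !addr0 addrC.
rewrite mulrDl raddfD /= -mulrA (mulrC 'X q) mulrA dMX.
have -> : \sum_(k < j.+1) (p * 'X + c%:P)^`N(k) * q^`N(j - k)
   = \sum_(k < j.+1) p^`N(k) * q^`N(j - k) * 'X
   + \sum_(k < j.+1) (if (k : nat) is l.+1 then p^`N(l) else 0) * q^`N(j - k)
   + \sum_(k < j.+1) (c%:P)^`N(k) * q^`N(j - k).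
  rewrite -!big_split; apply: eq_bigr => k _ /=.
  by rewrite raddfD /= dMX !mulrDl mulrAC.
congr (_ + _); last first.
  rewrite big_ord_recl nderivn0 subn0 big1 ?addr0 => [|k _]; last first.
    by rewrite nderivnC mul0r.
  by rewrite !mul_polyC linearZ.
congr (_ + _); first by rewrite IH mulr_suml.
case: j => [|j]; first by rewrite big_ord1 mul0r.
by rewrite big_ord_recl mul0r add0r IH.
Qed.

Lemma map_nderivn_hasse_schmidt (A : comNzRingType) :
  hasse_schmidt (fun j (p : {poly {poly A}}) => map_poly (fun c => c^`N(j)) p).
Proof.
have [H0 HA HM] := nderivn_hasse_schmidt A.
have cm j (p : {poly {poly A}}) i :
    (map_poly (fun c => c^`N(j)) p)`_i = (p`_i)^`N(j).
  by rewrite coef_map_id0 // raddf0.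
split=> [p|j p q|j p q]; apply/polyP=> i; rewrite cm.
- by rewrite H0.
- by rewrite !coefD !cm HA.
rewrite coefM raddf_sum coef_sum /=.
under eq_bigr => k _ do rewrite HM.
rewrite exchange_big; apply: eq_bigr => k _ /=; rewrite coefM.
by apply: eq_bigr => l _; rewrite !cm.
Qed.

Lemma hasse_x_hasse_schmidt : hasse_schmidt hasse_x.
Proof. exact/hasse_frac_hasse_schmidt/nderivn_hasse_schmidt. Qed.

Lemma hasse_z_hasse_schmidt : hasse_schmidt hasse_z.
Proof. exact/hasse_frac_hasse_schmidt/map_nderivn_hasse_schmidt. Qed.

Lemma hasse_x_xn j i : hasse_x j (rf_x ^+ i) = rf_x ^+ (i - j) *+ 'C(i, j).
Proof.
rewrite -rmorphXn [LHS]hasse_frac_tofrac; last exact: nderivn_hasse_schmidt.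
by rewrite nderivnXn rmorphMn rmorphXn.
Qed.

Lemma hasse_z_zn j i : hasse_z j (rf_z ^+ i) = rf_z ^+ (i - j) *+ 'C(i, j).
Proof.
rewrite -rmorphXn [LHS]hasse_frac_tofrac; last exact: map_nderivn_hasse_schmidt.
have -> : map_poly (fun c => c^`N(j)) ('X%:P ^+ i : poly3 E)
        = 'X%:P ^+ (i - j) *+ 'C(i, j).
  rewrite -!polyC_exp -polyCMn -nderivnXn; apply/polyP=> k.
  rewrite coef_map_id0 ?raddf0 // !coefC.
  by case: eqP => // _; rewrite raddf0.
by rewrite rmorphMn rmorphXn.
Qed.

Lemma ratfun3_evalE x y z (a b : poly3 E) : poly3_eval x y z b != 0 ->
  ratfun3_eval x y z (a%:F / b%:F) = poly3_eval x y z a / poly3_eval x y z b.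
Proof.
move=> b0; rewrite /ratfun3_eval; set S := [set v | _]%classic.
have evM p q : poly3_eval x y z (p * q) = poly3_eval x y z p * poly3_eval x y z q.
  by rewrite /poly3_eval !hornerM.
have nz p : poly3_eval x y z p != 0 -> p%:F != 0 :> ratfun3 E.
  by rewrite tofrac_eq0; apply: contra_neq => ->; rewrite /poly3_eval !horner0.
have [a' [b' [b'0 e ->]]] : S (xget 0 S).
  by apply: xgetPex; exists (poly3_eval x y z a / poly3_eval x y z b); exists a, b.
apply/eqP; rewrite eqr_div // -!evM; apply/eqP; congr poly3_eval.
by apply/eqP; rewrite -tofrac_eq !tofracM -eqr_div ?nz // e.
Qed.

End RatFun3.

(* A series [\sum_i M_i tau^i] is its sequence of coefficients [i |-> M_i]. *)
Definition mx_twist (A : comNzRingType) (q k m n : nat) (M : 'M[A]_(m, n)) :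
  'M[A]_(m, n) := map_mx (fun c => c ^+ (q ^ k)) M.

Definition tmono (A : comNzRingType) (d : nat) (k : nat) (M : 'M[A]_d) :
  nat -> 'M[A]_d := fun n => if n == k then M else 0.

Definition tmul (A : comNzRingType) (q d : nat) (f g : nat -> 'M[A]_d) :
  nat -> 'M[A]_d :=
  fun n => \sum_(i < n.+1) f i *m mx_twist q i (g (n - i)%N).

Section Carlitz.
Variable F : finFieldType.

Local Notation q := #|F|.
Local Notation K := {fraction {poly F}}.

Definition theta : K := ('X : {poly F})%:F.

Variable d : nat.

Definition Nmx : 'M[K]_d := \matrix_(i, j) (j == i.+1 :> nat)%:R.
Definition e_d1 : 'M[K]_d := \matrix_(i, j) ((i.+1 == d) && (j == 0 :> nat))%:R.

Definition carlitz_theta : nat -> 'M[K]_d :=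
  tmono 0 (theta%:M + Nmx) \+ tmono 1 e_d1.

Definition is_exp_carlitz (Q : nat -> 'M[K]_d) : Prop :=
  Q 0%N = 1%:M
  /\ tmul q Q (tmono 0 (theta%:M + Nmx)) =1 tmul q carlitz_theta Q.

(* a(theta + N) for a in A = F_q[theta] *)
Definition poly_at_thetaN (a : {poly F}) : 'M[K]_d :=
  \sum_(i < size a) (a`_i)%:P%:F *: (theta%:M + Nmx) ^+ i.

Definition Lmx (i : nat) : 'M[K]_d :=
  map_mx (ratfun3_eval theta (theta ^+ (q ^ i.+1)) (theta ^+ q))
    (Delta d
      (f_poly d (rf_x K) (rf_y K) (rf_z K)
       * ((\prod_(1 <= k < i.+1) (rf_x K - rf_cst (theta ^+ (q ^ k))))
          / (\prod_(2 <= k < i.+2) (rf_z K - rf_cst (theta ^+ (q ^ k))))) ^+ d)).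

(* (1 - L_(k-1) tau) ... (1 - L_0 tau) *)
Fixpoint partial_prod (k : nat) : nat -> 'M[K]_d :=
  if k is i.+1 then tmul q (tmono 0 1%:M \- tmono 1 (Lmx i)) (partial_prod i)
  else tmono 0 1%:M.

End Carlitz.

Section Cinfty.
Variables (F : finFieldType) (R : realType) (C : fieldType).
Variables (iota : {rmorphism {fraction {poly F}} -> C}) (abs : C -> R).

Definition abs_cvg (u : nat -> C) (l : C) : Prop :=
  (abs (u n - l) @[n --> \oo] --> (0 : R))%classic.

Definition abs_cauchy (u : nat -> C) : Prop :=
  forall e : R, 0 < e ->
    exists n0, forall m n, (n0 <= m)%N -> (n0 <= n)%N -> abs (u m - u n) < e.

Definition mx_cvg (m n : nat) (u : nat -> 'M[C]_(m, n)) (l : 'M[C]_(m, n)) : Prop :=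
  forall i j, abs_cvg (fun k => u k i j) (l i j).

(* K_infty = F_q((1/theta)), as the subfield of C of the sums of the series
   [\sum_i a_i theta^(n - i)] with a_i in F_q. *)
Definition in_Kinfty (x : C) : Prop :=
  exists (n : nat) (a : nat -> F),
    abs_cvg (fun m => \sum_(i < m) iota (a i)%:P%:F * iota (theta F) ^ (n%:Z - i%:Z)) x.

Definition algebraic_over_Kinfty (x : C) : Prop :=
  exists p : {poly C}, [/\ p != 0, forall i, in_Kinfty p`_i & root p x].

(* (C, iota, abs) is the completion of an algebraic closure of K_infty: C is
   complete, and its elements algebraic over K_infty form a dense algebraically
   closed subfield. Since F_q is finite and |theta| > 1, [abs] restricts on K to
   the absolute value of the place at infinity. *)
Record is_Cinfty : Prop := IsCinfty {
  Cinfty_abs_ge0 : forall x, 0 <= abs x;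
  Cinfty_abs_eq0 : forall x, abs x = 0 <-> x = 0;
  Cinfty_absM : forall x y, abs (x * y) = abs x * abs y;
  Cinfty_absD : forall x y, abs (x + y) <= Num.max (abs x) (abs y);
  Cinfty_abs_theta : 1 < abs (iota (theta F));
  Cinfty_complete : forall u, abs_cauchy u -> exists l, abs_cvg u l;
  Cinfty_closure : forall p : {poly C}, (1 < size p)%N ->
    (forall i, algebraic_over_Kinfty p`_i) ->
    exists2 x, algebraic_over_Kinfty x & root p x;
  Cinfty_dense : forall x (e : R), 0 < e ->
    exists2 y, algebraic_over_Kinfty y & abs (x - y) < e
}.

Variable d : nat.

Definition series_map (M : nat -> 'M[{fraction {poly F}}]_d) : nat -> 'M[C]_d :=
  fun i => map_mx iota (M i).

(* [M] converges at [Z], with value [W]. *)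
Definition series_act (M : nat -> 'M[C]_d) (Z W : 'cV[C]_d) : Prop :=
  mx_cvg (fun n => \sum_(i < n) M i *m mx_twist #|F| i Z) W.

Definition is_period (Q : nat -> 'M[{fraction {poly F}}]_d) (Pi : 'cV[C]_d) : Prop :=
  Pi != 0 /\
  forall Z : 'cV[C]_d, series_act (series_map Q) Z 0 <->
    exists a : {poly F}, Z = map_mx iota (poly_at_thetaN d a) *m Pi.

(* Pi = (pi_(d-1), ..., pi_1, pi_0)^T *)
Definition period_coord (Pi : 'cV[C]_d) (k : 'I_d) : C := Pi (rev_ord k) ord0.

Definition ord_sub (j i : 'I_d) : 'I_d :=
  Ordinal (leq_ltn_trans (leq_subr i j) (ltn_ord j)).

Definition period_mx (Pi : 'cV[C]_d) : 'M[C]_d :=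
  \matrix_(i, j) (if (i <= j)%N then period_coord Pi (ord_sub j i) else 0).

(* If the coefficient of tau^0, [invmx P *m P], is 1 then [P = period_mx Pi] is
   invertible, so the convention [invmx P = P] for singular [P] is harmless. *)
Definition sinA (Q : nat -> 'M[{fraction {poly F}}]_d) (Pi : 'cV[C]_d) :
  nat -> 'M[C]_d :=
  tmul #|F| (tmul #|F| (tmono 0 (invmx (period_mx Pi))) (series_map Q))
            (tmono 0 (period_mx Pi)).

End Cinfty.

(* Main.v *)
Require Import Defs.
From HB Require Import structures.
From mathcomp Require Import all_boot all_order all_algebra fraction.
From mathcomp Require Import all_classical all_reals all_analysis.
From mathcomp Require Import finfield zify ring.

Set Implicit Arguments.
Unset Strict Implicit.
Unset Printing Implicit Defensive.

Import Order.TTheory GRing.Theory Num.Theory.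
Import numFieldNormedType.Exports.
Local Open Scope ring_scope.

(* In terms of jets: a tau-polynomial applied to the jet
   (D_(d-1) a(theta), ..., a(theta)) of a polynomial a over F_q reads off the jets
   of a at theta, theta^q, theta^(q^2), .... The partial product P_k turns out to be
   the error functional at theta of Hermite interpolation at
   theta^q, ..., theta^(q^k) with multiplicity d: its constant term is 1, and it
   kills all polynomials of degree < dk. Uniqueness of Hermite interpolation gives
   P_k (theta + N) = (theta + N) P_k + M_k tau P_(k-1), where M_k has rank one and is
   explicit in W_k = \prod_(1 <= j <= k) (1 - x / theta^(q^j))^d. Since
   |L_k| <= |theta|^(dq - q^(k+1)), the P_k converge to an everywhere convergent
   series S, and Omega = lim W_k(theta + N) conjugates the functional equation of S
   into that of the exponential: exp = kappa Omega^-1 S Omega kappa^-1, where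
   kappa^(q-1) = (-theta^q)^d. Hence kappa Omega^-1 e_d is a period, equal to
   a(theta + N) Pi for some a in A, and S vanishes on the jets at theta of all c / a,
   c in A. This forces a to be constant: otherwise reduce W_k modulo a to express
   the value W_k(theta) / a(theta) of P_k on W_k / a, which has a fixed positive
   norm, through the values of P_k on finitely many x^i / a, which tend to 0. Thus
   hat Pi is a multiple of kappa Omega^-1 by an element of F_q, and S is the sine. *)

(** * Hasse-Schmidt derivations and jets *)

Section HasseSchmidt.
Variables (B : comNzRingType) (D : nat -> B -> B).
Hypothesis HD : hasse_schmidt D.

Lemma hs0 a : D 0%N a = a. Proof. by case: HD. Qed.
Lemma hsD j a b : D j (a + b) = D j a + D j b. Proof. by case: HD. Qed.
Lemma hsM j a b : D j (a * b) = \sum_(k < j.+1) D k a * D (j - k)%N b.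
Proof. by case: HD. Qed.

Lemma hs_0 j : D j 0 = 0.
Proof. by apply: (@addrI _ (D j 0)); rewrite -hsD !addr0. Qed.

Lemma hsN j a : D j (- a) = - D j a.
Proof. by apply: (@addrI _ (D j a)); rewrite -hsD !subrr hs_0. Qed.

Lemma hs_sum j (I : Type) (r : seq I) (P : pred I) (f : I -> B) :
  D j (\sum_(i <- r | P i) f i) = \sum_(i <- r | P i) D j (f i).
Proof. by elim/big_rec2: _ => [|i x y _ <-]; rewrite ?hs_0 ?hsD. Qed.

Definition hs_const c := forall j, (0 < j)%N -> D j c = 0.

Lemma hs_constM j c a : hs_const c -> D j (c * a) = c * D j a.
Proof.
move=> hc; rewrite hsM big_ord_recl /= hs0 subn0 big1 ?addr0 // => k _.
by rewrite hc // mul0r.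
Qed.

(** The Leibniz rule for [1 * 1] contains [D j 1] twice, and its middle terms vanish by
    induction. *)
Lemma hs_const1 : hs_const 1.
Proof.
move=> j; elim/ltn_ind: j => -[//|j] IH _.
have := hsM j.+1 1 1; rewrite mulr1 big_ord_recl /= hs0 subn0 mul1r.
rewrite big_ord_recr /= /bump /= add1n subnn hs0 mulr1 big1 => [|k _]; last first.
  by rewrite IH ?mul0r //= /bump /= add1n ltnS.
rewrite add0r => /eqP; rewrite -subr_eq0 opprD addrA subrr add0r oppr_eq0.
by move/eqP.
Qed.

Lemma hs_constM2 a b : hs_const a -> hs_const b -> hs_const (a * b).
Proof. by move=> ha hb j j0; rewrite hs_constM // hb // mulr0. Qed.

Lemma hs_constX a n : hs_const a -> hs_const (a ^+ n).
Proof.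
move=> ha; elim: n => [|n IH]; first exact: hs_const1.
by rewrite exprS; apply: hs_constM2.
Qed.

Lemma hs_constB a b : hs_const a -> hs_const b -> hs_const (a - b).
Proof. by move=> ha hb j j0; rewrite hsD hsN ha // hb // subrr. Qed.

Lemma hs_constMn a n : hs_const a -> hs_const (a *+ n).
Proof.
move=> ha j j0; elim: n => [|n IH]; first by rewrite mulr0n hs_0.
by rewrite mulrS hsD IH ha ?addr0.
Qed.

(** Applied below to the shifted variables [X - z], [x - y] and [z - y]; the induction on [m] is
    Pascal's rule. *)
Lemma hs_varX w j m : D 1%N w = 1 -> (forall i, (1 < i)%N -> D i w = 0) ->
  D j (w ^+ m) = w ^+ (m - j) *+ 'C(m, j).
Proof.
move=> w1 w2; elim: m j => [|m IH] [|j]; rewrite ?hs0 ?bin0 ?subn0 //.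
  by rewrite expr0 hs_const1 // bin0n.
rewrite exprS hsM big_ord_recl /= hs0 ?subn0 big_ord_recl /= /bump /= w1 mul1r.
rewrite big1 ?addr0 => [|k _]; last by rewrite w2 ?mul0r.
rewrite !subSS ?subn0 !IH binS mulrnDr; congr (_ + _).
case: (leqP j.+1 m) => [le_jm|lt_mj]; last by rewrite bin_small // !mulr0n mulr0.
by rewrite mulrnAr -exprS subnSK.
Qed.

End HasseSchmidt.

(** * Toeplitz matrices f(z + N) and jets *)

Section JetMatrices.
Variables (E : fieldType) (d : nat).
Implicit Types (f g : {poly E}) (z : E).

(** By Taylor's formula this is f(z + N), where N is the nilpotent shift. *)
Definition toep_mx z f : 'M[E]_d :=
  \matrix_(i, j) if (i <= j)%N then f^`N(j - i).[z] else 0.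

(** The last column of [toep_mx z f], that is, f(z + N) applied to the last basis vector. *)
Definition jet z f : 'cV[E]_d := \col_i f^`N(d - i.+1).[z].

Lemma nderivnM j f g : (f * g)^`N(j) = \sum_(k < j.+1) f^`N(k) * g^`N(j - k).
Proof. exact: (hsM (nderivn_hasse_schmidt E)). Qed.

Lemma toep_mxM z f g : toep_mx z (f * g) = toep_mx z f *m toep_mx z g.
Proof.
apply/matrixP=> i j; rewrite !mxE.
under [RHS]eq_bigr => k _ do rewrite !mxE.
case: (leqP i j) => [le_ij|lt_ji]; last first.
  rewrite big1 // => k _; case: (leqP i k) => [le_ik|]; last by rewrite mul0r.
  by rewrite leqNgt (leq_trans lt_ji le_ik) mulr0.
rewrite nderivnM horner_sum.
rewrite -(big_mkord xpredT (fun k => (f^`N(k) * g^`N(j - i - k)).[z])).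
rewrite -(big_mkord xpredT (fun k : nat => (if (i <= k)%N then f^`N(k - i).[z] else 0)
   * (if (k <= j)%N then g^`N(j - k).[z] else 0))).
rewrite [RHS](big_cat_nat (leq0n i)) ?(ltnW (ltn_ord i)) //=.
rewrite [X in _ = X + _]big_nat [X in _ = X + _]big1 ?add0r => [|k /andP[_ lt_ki]]; last first.
  by rewrite leqNgt lt_ki mul0r.
rewrite [in RHS](big_cat_nat (n:=j.+1)) ?ltnS ?(leqW le_ij) //=.
rewrite [X in _ = _ + X]big_nat [X in _ = _ + X]big1 ?addr0 => [|k /andP[lt_jk _]].
  rewrite [RHS](big_addn 0 _ i) subSn //.
  rewrite big_nat [RHS]big_nat; apply: eq_bigr => k /andP[_ hk].
  rewrite ltnS in hk.
  by rewrite hornerM leq_addl addnK -subnDA addnC (_ : (k + i <= j)%N) //; lia.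
by rewrite [X in _ * X]ifF ?mulr0 //; lia.
Qed.

Lemma jetM z f g : jet z (f * g) = toep_mx z f *m jet z g.
Proof.
apply/matrixP=> i j; rewrite !mxE.
under [RHS]eq_bigr => k _ do rewrite !mxE.
rewrite nderivnM horner_sum.
rewrite -(big_mkord xpredT (fun k => (f^`N(k) * g^`N(d - i.+1 - k)).[z])).
rewrite -(big_mkord xpredT (fun k : nat => (if (i <= k)%N then f^`N(k - i).[z] else 0)
   * g^`N(d - k.+1).[z])).
rewrite [RHS](big_cat_nat (leq0n i)) ?(ltnW (ltn_ord i)) //=.
rewrite [X in _ = X + _]big_nat [X in _ = X + _]big1 ?add0r => [|k /andP[_ lt_ki]]; last first.
  by rewrite leqNgt lt_ki mul0r.
rewrite [RHS](big_addn 0 _ i) subnSK //.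
rewrite big_nat [RHS]big_nat; apply: eq_bigr => k /andP[_ hk].
rewrite hornerM leq_addl addnK -subnDA; congr (_ * _^`N(_).[_]); lia.
Qed.

Lemma jetD z f g : jet z (f + g) = jet z f + jet z g.
Proof. by apply/matrixP=> i j; rewrite !mxE nderivnD hornerD. Qed.

Lemma jetZ z c f : jet z (c *: f) = c *: jet z f.
Proof. by apply/matrixP=> i j; rewrite !mxE nderivnZ hornerZ. Qed.

Lemma jet0 z : jet z 0 = 0.
Proof. by rewrite -(scale0r 0) jetZ scale0r. Qed.

Lemma jet_sum z (I : Type) (r : seq I) (P : pred I) (f : I -> {poly E}) :
  jet z (\sum_(i <- r | P i) f i) = \sum_(i <- r | P i) jet z (f i).
Proof. by elim/big_rec2: _ => [|i x y _ <-]; rewrite ?jet0 ?jetD. Qed.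

Lemma toep_mxZ z c f : toep_mx z (c *: f) = c *: toep_mx z f.
Proof.
by apply/matrixP=> i j; rewrite !mxE; case: ifP; rewrite ?mulr0 // nderivnZ hornerZ.
Qed.

Lemma toep_mxD z f g : toep_mx z (f + g) = toep_mx z f + toep_mx z g.
Proof.
by apply/matrixP=> i j; rewrite !mxE; case: ifP; rewrite ?addr0 // nderivnD hornerD.
Qed.

Lemma toep_mxC z c : toep_mx z c%:P = c%:M.
Proof.
apply/matrixP=> i j; rewrite !mxE -val_eqE /=.
case: ltngtP => [lt_ij|lt_ji|<-]; rewrite ?mulr0n //; last first.
  by rewrite subnn nderivn0 hornerC.
by rewrite (_ : (j - i = (j - i).-1.+1)%N) ?nderivnC ?horner0 // prednK // subn_gt0.
Qed.

Lemma toep_mxX z : toep_mx z 'X = z%:M + \matrix_(i, j) (j == i.+1 :> nat)%:R.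
Proof.
apply/matrixP=> i j; rewrite !mxE -val_eqE /=.
case: ltngtP => [lt_ij|lt_ji|<-].
- rewrite add0r -['X]expr1 nderivnXn hornerMn hornerXn.
  case: (eqVneq (j : nat) i.+1) => [->|ne]; first by rewrite subSnn bin1 expr0.
  by rewrite bin_small //; lia.
- by rewrite add0r (_ : (_ == _) = false) //; apply/eqP; lia.
- by rewrite subnn nderivn0 hornerX (_ : (_ == _) = false) ?addr0 //; apply/eqP; lia.
Qed.

Lemma toep_mxCM z f g : toep_mx z f *m toep_mx z g = toep_mx z g *m toep_mx z f.
Proof. by rewrite -!toep_mxM mulrC. Qed.

Lemma nderivn_XsubCX z m j : (('X - z%:P) ^+ m)^`N(j) = ('X - z%:P) ^+ (m - j) *+ 'C(m, j).
Proof.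
have HD := nderivn_hasse_schmidt E; apply: (hs_varX HD).
  by rewrite nderivnB nderivn1 derivX -[1%N]/(0.+1) nderivnC subr0.
case=> [|[|i]] // _; rewrite nderivnB nderivnC subr0 -['X]expr1 nderivnXn.
by rewrite bin_small.
Qed.

Lemma nderivn_XsubCX_root z m j : (('X - z%:P) ^+ m)^`N(j).[z] = (j == m)%:R.
Proof.
rewrite nderivn_XsubCX hornerMn horner_exp hornerXsubC subrr expr0n.
case: (ltngtP j m) => [lt_jm|lt_mj|->]; last by rewrite subnn binn.
  by rewrite subn_eq0 leqNgt lt_jm mul0rn.
by rewrite bin_small.
Qed.

(** These powers realize every basis vector as a jet, so identities of matrices can be tested column
    by column on polynomials. *)
Lemma jet_XsubCX z (j : 'I_d) : jet z (('X - z%:P) ^+ (d - j.+1)) = delta_mx j 0.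
Proof.
apply/matrixP=> i k; rewrite !mxE nderivn_XsubCX_root ord1 eqxx andbT -val_eqE /=.
congr (_%:R : E); congr nat_of_bool; apply/eqP/eqP; case: i j => i hi [j hj] /=; lia.
Qed.

Lemma toep_mx_XsubCX z m : (d <= m)%N -> toep_mx z (('X - z%:P) ^+ m) = 0.
Proof.
move=> le_dm; apply/matrixP=> i j; rewrite !mxE nderivn_XsubCX_root; case: ifP => //.
by rewrite (_ : (_ == _) = false) //; apply/eqP; case: i j => i hi [j hj] /=; lia.
Qed.

Lemma jet_XsubCX_mul z m g : (d <= m)%N -> jet z (('X - z%:P) ^+ m * g) = 0.
Proof. by move=> le_dm; rewrite jetM toep_mx_XsubCX ?mul0mx. Qed.

Lemma det_toep_mx z f : \det (toep_mx z f) = f.[z] ^+ d.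
Proof.
rewrite -det_tr det_trig.
  rewrite (eq_bigr (fun=> f.[z])) ?prodr_const ?card_ord // => i _.
  by rewrite !mxE leqnn subnn nderivn0.
by apply/is_trig_mxP => i j lt_ij; rewrite !mxE leqNgt lt_ij.
Qed.

Lemma toep_mx_unit z f : f.[z] != 0 -> toep_mx z f \in unitmx.
Proof. by move=> fz; rewrite unitmxE det_toep_mx unitfE expf_neq0. Qed.

Lemma poly_jet z g : (size g <= d)%N ->
  g = \sum_(j < d) jet z g j 0 *: ('X - z%:P) ^+ (d - j.+1).
Proof.
move=> sg.
have -> : \sum_(j < d) jet z g j 0 *: ('X - z%:P) ^+ (d - j.+1)
        = \sum_(i < d) (g^`N(i)).[z] *: ('X - z%:P) ^+ i.
  rewrite (reindex_inj rev_ord_inj); apply: eq_bigr => i _ /=.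
  by rewrite !mxE /= (_ : (d - (d - i.+1).+1 = i)%N) //; case: i => i hi /=; lia.
(* Taylor's formula is used over [{poly E}], at z + (X - z) = X, so that it returns [g] itself and
   not one of its values. *)
have := @nderiv_taylor_wide {poly E} d (g^:P) z%:P ('X - z%:P) (mulrC _ _).
rewrite (size_map_polyC g) => /(_ sg).
rewrite addrC subrK -[_.['X]]/(g \Po 'X) comp_polyXr => {1}->.
by apply: eq_bigr => i _; rewrite nderivn_map horner_map mul_polyC.
Qed.

End JetMatrices.

(** * Hermite interpolation *)

Lemma size_monic_sub (A : nzRingType) n (f g : {poly A}) : f \is monic -> g \is monic ->
  size f = n.+1 -> size g = n.+1 -> (size (f - g)%R <= n)%N.
Proof.
move=> /monicP mf /monicP mg sf sg; apply/leq_sizeP => j le_nj; rewrite coefB.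
move: le_nj; rewrite leq_eqVlt => /predU1P[<-|lt_nj].
  by move: mf mg; rewrite !lead_coefE sf sg => -> ->; rewrite subrr.
by rewrite !nth_default ?subrr ?sf ?sg.
Qed.

Section JetFunctional.
Variables (E : fieldType) (d : nat).
Implicit Types (R : nat -> 'M[E]_d) (xi : nat -> E) (f g : {poly E}).

Definition jet_fun n R xi f : 'cV[E]_d := \sum_(j < n) R j *m jet d (xi j) f.

Lemma jet_funD n R xi f g : jet_fun n R xi (f + g) = jet_fun n R xi f + jet_fun n R xi g.
Proof. by rewrite -big_split; apply: eq_bigr => j _; rewrite jetD mulmxDr. Qed.

Lemma jet_funZ n R xi c f : jet_fun n R xi (c *: f) = c *: jet_fun n R xi f.
Proof. by rewrite scaler_sumr; apply: eq_bigr => j _; rewrite jetZ scalemxAr. Qed.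

Lemma jet_fun0 n R xi : jet_fun n R xi 0 = 0.
Proof. by rewrite /jet_fun big1 // => j _; rewrite jet0 mulmx0. Qed.

Lemma jet_fun_sum n R xi (I : Type) (r : seq I) (P : pred I) (f : I -> {poly E}) :
  jet_fun n R xi (\sum_(i <- r | P i) f i) = \sum_(i <- r | P i) jet_fun n R xi (f i).
Proof. by elim/big_rec2: _ => [|i x y _ <-]; rewrite ?jet_fun0 ?jet_funD. Qed.

Definition kills n R xi m := forall f, (size f <= m)%N -> jet_fun n R xi f = 0.

Lemma kills_congr n R xi m f g : kills n R xi m -> (size (f - g)%R <= m)%N ->
  jet_fun n R xi f = jet_fun n R xi g.
Proof.
move=> hk /hk; rewrite -scaleN1r jet_funD jet_funZ scaleN1r => /eqP.
by rewrite subr_eq0 => /eqP.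
Qed.

Lemma kills_monomials n R xi m :
  (forall i, (i < m)%N -> jet_fun n R xi 'X^i = 0) -> kills n R xi m.
Proof.
move=> hm f sf; rewrite -[f]coefK poly_def jet_fun_sum big1 // => i _.
by rewrite jet_funZ hm ?scaler0 // (leq_trans (ltn_ord i)).
Qed.

Lemma size_prod_XsubCX n xi (P : pred 'I_n) :
  size (\prod_(j < n | P j) ('X - (xi j)%:P) ^+ d) = (d * #|P|).+1.
Proof.
rewrite size_prod => [|j _]; last by rewrite expf_neq0 ?polyXsubC_eq0.
rewrite (eq_bigr (fun=> d.+1)) => [|j _]; last by rewrite size_exp_XsubC.
by rewrite sum_nat_const mulnS -addnS addKn mulnC.
Qed.

(** Test on (X - xi_j)^(d-1-c) times the d-th powers of the factors of all other nodes: the degree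
    is below dn and only the jet at xi_j survives. It equals U(xi_j + N) applied to a basis vector,
    and U(xi_j + N) is invertible since the nodes are distinct. *)
Lemma hermite_uniq n R xi :
  (forall i j, (i < n)%N -> (j < n)%N -> xi i = xi j -> i = j) ->
  kills n R xi (d * n) -> forall j, (j < n)%N -> R j = 0.
Proof.
move=> xi_inj hk j lt_jn; pose j0 := Ordinal lt_jn.
pose U := \prod_(i < n | i != j0) ('X - (xi i)%:P) ^+ d.
have Uj : U.[xi j] != 0.
  rewrite horner_prod; apply/prodf_neq0 => i ne_ij.
  rewrite horner_exp hornerXsubC expf_neq0 // subr_eq0; apply: contra ne_ij.
  by move=> /eqP /xi_inj e; apply/eqP/val_inj; rewrite /= e.
suff: R j *m toep_mx d (xi j) U = 0.
  by move=> e; rewrite -[R j](mulmxK (toep_mx_unit d Uj)) e mul0mx.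
have colE (A B : 'M[E]_d) : (forall c : 'I_d, A *m delta_mx c (0 : 'I_1) = B *m delta_mx c 0) -> A = B.
  move=> h; apply/matrixP => a b.
  by have /matrixP/(_ a 0) := h b; rewrite -!colE !mxE.
apply: colE => c; rewrite mul0mx -mulmxA -(jet_XsubCX (xi j)) -jetM.
have := hk (U * ('X - (xi j)%:P) ^+ (d - c.+1)).
rewrite /jet_fun (bigD1 j0) //= big1 ?addr0 => [|i ne_ij]; last first.
  by rewrite /U (bigD1 i) // -!mulrA jet_XsubCX_mul ?mulmx0.
apply; rewrite size_Mmonic ?monicXsubC ?monic_exp ?monicXsubC //; last first.
  by rewrite -size_poly_gt0 size_prod_XsubCX.
rewrite size_prod_XsubCX size_exp_XsubC cardC1 card_ord.
by case: c => c hc /=; nia.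
Qed.

End JetFunctional.

(* The tau-polynomial P_k has coefficients [twisted_prod k], and acts on the
   jet at t of a polynomial f as [f |-> \sum_j P_(k,j) J(f, t^(q^j))], the jets of
   f at the nodes t^(q^j) being the Frobenius twists of the jet at t when the
   coefficients of f lie in F_q. *)
Section Interpolation.
Variables (E : fieldType) (d q : nat) (phi : {rmorphism E -> E}).
Hypothesis phiE : forall x, phi x = x ^+ q.
Variable t : E.

Definition node j := t ^+ (q ^ j).

Lemma phi_node j : phi (node j) = node j.+1.
Proof. by rewrite phiE -exprM -expnSr. Qed.

Hypothesis node_inj : injective node.

Definition node_poly a b : {poly E} := \prod_(a <= j < b) ('X - (node j)%:P) ^+ d.

Lemma node_poly_monic a b : node_poly a b \is monic.
Proof. by apply: monic_prod => j _; rewrite monic_exp ?monicXsubC. Qed.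

Lemma size_node_poly a b : size (node_poly a b) = (d * (b - a)).+1.
Proof.
rewrite /node_poly -{1}[a]add0n big_addn big_mkord.
rewrite (size_prod_XsubCX _ (fun j => node (j + a)%N)); congr (d * _).+1.
by rewrite -[RHS]card_ord; apply: eq_card.
Qed.

Lemma jet_node_poly a b j g : (a <= j < b)%N -> jet d (node j) (node_poly a b * g) = 0.
Proof.
move=> /andP[le_aj lt_jb]; rewrite /node_poly (big_cat_nat le_aj (ltnW lt_jb)) /=.
by rewrite (big_ltn lt_jb) mulrCA -mulrA jet_XsubCX_mul.
Qed.

Variable L : nat -> 'M[E]_d.

Fixpoint twisted_prod k : nat -> 'M[E]_d :=
  if k is i.+1 then fun n =>
    twisted_prod i n - (if n is m.+1 then L i *m map_mx phi (twisted_prod i m) else 0)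
  else fun n => if n == 0%N then 1%:M else 0.

Lemma twisted_prod0 k : twisted_prod k 0 = 1%:M.
Proof. by elim: k => //= k ->; rewrite subr0. Qed.

Lemma twisted_prod_gt k j : (k < j)%N -> twisted_prod k j = 0.
Proof.
elim: k j => [|k IH] [|j] //= lt_kj.
by rewrite !IH ?map_mx0 ?mulmx0 ?subrr // ltnW.
Qed.

Lemma map_jet_phi z i : map_mx phi (jet d z 'X^i) = jet d (phi z) 'X^i.
Proof.
apply/matrixP=> a b; rewrite !mxE nderivnXn !hornerMn !hornerXn.
by rewrite rmorphMn rmorphXn.
Qed.

(** Frobenius sends the jet of a monomial at a node to its jet at the next node, and monomials
    suffice by linearity. *)
Lemma kills_twist n (R : nat -> 'M[E]_d) m : kills n R node m ->
  kills n (fun j => map_mx phi (R j)) (fun j => node j.+1) m.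
Proof.
move=> hk; apply: kills_monomials => i lt_im.
transitivity (map_mx phi (jet_fun n R node 'X^i)); last first.
  by rewrite hk ?map_mx0 // size_polyXn.
rewrite /jet_fun map_mx_sum; apply: eq_bigr => j _.
by rewrite map_mxM map_jet_phi phi_node.
Qed.

(** The j-th hyperderivative in z of f_d(x, y, z), at z = t^q and y = t^(q^(k+1)), as a polynomial
    in x. Thus [bmx k] is Delta(f_d) at the point where L_k is evaluated. *)
Definition bcol k (j : 'I_d) : {poly E} :=
  \sum_(m < d) ((node 1 - node k.+1) ^+ (m - j) *+ 'C(m, j)) *:
     ('X - (node k.+1)%:P) ^+ (d - m.+1).

Definition bmx k : 'M[E]_d := \matrix_(i, j) jet d t (bcol k j) i 0.

(** A truncation at m < n of the identity (u - c)^-(j+2) (u - c) = (u - c)^-(j+1), expanded in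
    powers of c / u and multiplied by u^n; the last term is the boundary contribution. *)
Lemma bcol_rec (B : comNzRingType) (u c : B) (n j : nat) :
  (\sum_(m < n) c ^+ (m - j.+1) *+ 'C(m, j.+1) * u ^+ (n - m.+1)) * (u - c)
  = \sum_(m < n) c ^+ (m - j) *+ 'C(m, j) * u ^+ (n - m.+1)
    - c ^+ (n - j.+1) *+ 'C(n, j.+1).
Proof.
have rec i k : \sum_(m < k.+1) c ^+ (m - i) *+ 'C(m, i) * u ^+ (k.+1 - m.+1)
   = u * (\sum_(m < k) c ^+ (m - i) *+ 'C(m, i) * u ^+ (k - m.+1)) + c ^+ (k - i) *+ 'C(k, i).
  rewrite big_ord_recr /= subnn expr0 mulr1 mulr_sumr; congr (_ + _).
  apply: eq_bigr => m _; rewrite mulrCA -exprS; congr (_ * _ ^+ _).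
  by have := ltn_ord m; lia.
elim: n => [|n IH]; first by rewrite !big_ord0 mul0r bin0n mulr0n subr0.
rewrite !rec mulrDl -mulrA IH subSS binS mulrnDr.
have -> : c ^+ (n - j.+1) *+ 'C(n, j.+1) * (u - c)
        = u * (c ^+ (n - j.+1) *+ 'C(n, j.+1)) - c ^+ (n - j) *+ 'C(n, j.+1).
  rewrite mulrBr mulrC; congr (_ - _).
  case: (leqP j.+1 n) => [le_jn|lt_nj]; last by rewrite bin_small // !mulr0n mul0r.
  by rewrite mulrnAl -exprSr subnSK.
by ring.
Qed.

(* Expansion of (X - y)^d / (X - z)^(j+1) in powers of X - y, up to a term of
   negative degree. *)
Lemma bcol_congr (y z : E) j :
  (size ((\sum_(m < d) ((z - y) ^+ (m - j) *+ 'C(m, j)) *: ('X - y%:P) ^+ (d - m.+1))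
     * ('X - z%:P) ^+ j.+1 - ('X - y%:P) ^+ d)%R <= j.+1)%N.
Proof.
set u := 'X - y%:P; set c := z - y.
have zE : 'X - z%:P = u - c%:P by rewrite /c /u polyCB; ring.
have bE i : \sum_(m < d) (c ^+ (m - i) *+ 'C(m, i)) *: u ^+ (d - m.+1)
   = \sum_(m < d) c%:P ^+ (m - i) *+ 'C(m, i) * u ^+ (d - m.+1).
  by apply: eq_bigr => m _; rewrite -mul_polyC polyCMn polyC_exp.
have sC (k : nat) (p : {poly E}) (a : E) n : (size p <= n)%N -> (size (p * (a%:P ^+ k))%R <= n)%N.
  by move=> sp; rewrite -polyC_exp mulrC mul_polyC (leq_trans (size_scale_leq _ _)).
rewrite bE; elim: j => [|j IH].
  (* For j = 0 the sum is geometric: its product with u - c is u^d - c^d, so the error is a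
     constant. *)
  rewrite expr1 zE.
  have -> : \sum_(m < d) c%:P ^+ (m - 0) *+ 'C(m, 0) * u ^+ (d - m.+1)
     = \sum_(m < d) u ^+ (d.-1 - m) * c%:P ^+ m.
    apply: eq_bigr => m _; rewrite subn0 bin0 mulr1n mulrC.
    by rewrite (_ : (d - m.+1 = d.-1 - m)%N) //; lia.
  rewrite mulrC -subrXX addrC addrA addNr add0r size_polyN -polyC_exp.
  by rewrite size_polyC leq_b1.
rewrite exprS mulrA {1}zE bcol_rec mulrBl -addrA [- _ - _]addrC addrA -bE.
rewrite bE (leq_trans (size_polyD _ _)) // geq_max (leq_trans IH) //=.
rewrite size_polyN mulrC mulrnAr -mulrnAl.
apply: sC; rewrite -scaler_nat (leq_trans (size_scale_leq _ _)) //.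
by rewrite size_exp_XsubC.
Qed.

(** The definition of L_k with its denominator cleared; [Lmx_factor] establishes it over K and
    [Lmx_C_factor] transports it to [C]. *)
Hypothesis LE : forall k,
  L k *m toep_mx d (node 1) (node_poly 2 k.+2) = toep_mx d t (node_poly 1 k.+1) *m bmx k.

Let node0 : node 0 = t. Proof. by rewrite /node expn0 expr1. Qed.

Lemma jet_fun_node_poly k (R : nat -> 'M[E]_d) g : R 0%N = 1%:M ->
  jet_fun k.+1 R node (node_poly 1 k.+1 * g) = jet d t (node_poly 1 k.+1 * g).
Proof.
move=> R0; rewrite /jet_fun big_ord_recl /= R0 mul1mx node0 big1 ?addr0 // => j _.
by rewrite jet_node_poly ?mulmx0 //= /bump /=; have := ltn_ord j; lia.
Qed.

Lemma twisted_prod_jet_funS k f : jet_fun k.+2 (twisted_prod k.+1) node f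
  = jet_fun k.+1 (twisted_prod k) node f
    - L k *m jet_fun k.+1 (fun j => map_mx phi (twisted_prod k j)) (fun j => node j.+1) f.
Proof.
rewrite /jet_fun /=.
under eq_bigr => j _ do rewrite mulmxBl.
rewrite sumrB big_ord_recr /= twisted_prod_gt // mul0mx addr0; congr (_ - _).
rewrite big_ord_recl mul0mx add0r mulmx_sumr; apply: eq_bigr => j _.
by rewrite mulmxA.
Qed.

(* P_k is the error functional at t of Hermite interpolation at the
   nodes t^q, ..., t^(q^k), each of multiplicity d. *)
Lemma twisted_prod_kills k : kills k.+1 (twisted_prod k) node (d * k).
Proof.
elim: k => [|k IH] f.
  by rewrite muln0 leqn0 size_poly_eq0 => /eqP->; rewrite jet_fun0.
move=> sf; rewrite twisted_prod_jet_funS.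
have IH' := kills_twist IH.
pose W := node_poly 1 k.+1; pose W' := node_poly 2 k.+2.
have mW : W \is monic := node_poly_monic _ _.
have mW' : W' \is monic := node_poly_monic _ _.
have sW : size W = (d * k).+1 by rewrite size_node_poly subn1.
have sW' : size W' = (d * k).+1 by rewrite size_node_poly; congr (d * _).+1; lia.
(* Modulo degree < dk, where both P_k and its twist vanish, f may be replaced by W' g with deg g <
   d. The factor W' kills all jets at t^(q^2), ..., t^(q^(k+1)). *)
pose g := f %/ W'.
have sg : (size g <= d)%N by rewrite size_divp ?monic_neq0 // sW' leq_subLR -mulnSr.
have sfg : (size (f - W' * g)%R <= d * k)%N.
  rewrite {1}(divp_eq f W') -/g [g * _]mulrC addrC addrA addNr add0r -ltnS -sW'.
  by rewrite ltn_modp monic_neq0.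
pose z := node 1; pose y := node k.+1.
(* By [bcol_congr], G approximates g (X - y)^d / (X - z)^d, and its jet at t is [bmx k] applied to
   the jet of g at z. *)
pose G := \sum_(j < d) jet d z g j 0 *: bcol k j.
have sG : (size (('X - z%:P) ^+ d * G - ('X - y%:P) ^+ d * g)%R <= d)%N.
  rewrite {1}(poly_jet z sg) /G !mulr_sumr -sumrB.
  apply: (leq_trans (size_sum _ _ _)); apply/bigmax_leqP => j _.
  rewrite -!scalerAr -scalerBr (leq_trans (size_scale_leq _ _)) //.
  have -> : ('X - z%:P) ^+ d = ('X - z%:P) ^+ j.+1 * ('X - z%:P) ^+ (d - j.+1).
    by rewrite -exprD subnKC.
  rewrite mulrAC -mulrBl [_ * bcol k j]mulrC.
  apply: (leq_trans (size_polyMleq _ _)); rewrite size_exp_XsubC.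
  have h : (size (bcol k j * ('X - z%:P) ^+ j.+1 - ('X - y%:P) ^+ d)%R <= j.+1)%N.
    exact: bcol_congr.
  by move: h (ltn_ord j); move: (size _) => s; lia.
(* Since (X - z)^d W' = W (X - y)^d, the estimate [sG] times W is divisible by (X - z)^d, and the
   division lowers the degree by d. *)
have sWG : (size (W' * g - W * G)%R <= d * k)%N.
  have sX : size (('X - z%:P) ^+ d) = d.+1 by rewrite size_exp_XsubC.
  have XW : ('X - z%:P) ^+ d * W' = W * ('X - y%:P) ^+ d.
    rewrite /W /W' /node_poly -/z -/y.
    by rewrite -[RHS]big_nat_recr // [RHS]big_ltn.
  case: (eqVneq (W' * g - W * G) 0) => [->|ne0]; first by rewrite size_poly0.
  have := sG; rewrite -opprB size_polyN.
  have eq : ('X - z%:P) ^+ d * (W' * g - W * G)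
     = W * (('X - y%:P) ^+ d * g - ('X - z%:P) ^+ d * G).
    by rewrite !mulrBr !mulrA XW; ring.
  have := congr1 (size \o polyseq) eq => /=.
  case: (eqVneq (('X - y%:P) ^+ d * g - ('X - z%:P) ^+ d * G) 0) => [e0|ne1].
    move/eqP: eq; rewrite e0 mulr0 mulf_eq0 (negPf ne0) orbF.
    by rewrite -size_poly_eq0 sX.
  rewrite !size_monicM ?monic_exp ?monicXsubC // sX sW /=.
  by move: (size _) (size _) => a b; lia.
(* P_k now acts on W G, which it sees only at t, and the twist of P_k on W' g, which it sees only at
   t^q; [LE] makes the two contributions cancel. *)
rewrite (kills_congr IH sfg) (kills_congr IH sWG) (kills_congr IH' sfg).
rewrite jet_fun_node_poly ?twisted_prod0 //.
rewrite /jet_fun big_ord_recl big1 ?addr0 => [|j _]; last first.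
  rewrite jet_node_poly ?mulmx0 //= /bump /=; have := ltn_ord j; lia.
rewrite twisted_prod0 map_mx1 mul1mx [jet _ (node 1) _]jetM mulmxA LE jetM -mulmxA -mulmxBr.
suff -> : bmx k *m jet d (node 1) g = jet d t G by rewrite subrr mulmx0.
rewrite /G jet_sum; apply/matrixP => i c; rewrite ord1 summxE !mxE.
by apply: eq_bigr => j _; rewrite jetZ !mxE mulrC.
Qed.

Definition e_d1mx : 'M[E]_d := \matrix_(i, j) ((i.+1 == d) && (j == 0 :> nat))%:R.

(** The matrix M_k of P_k (theta + N) = (theta + N) P_k + M_k tau P_(k-1), read off from the
    coefficient of tau. *)
Definition conn_mx k := twisted_prod k 1 *m toep_mx d (node 1) 'X
  - toep_mx d t 'X *m twisted_prod k 1.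

Lemma jet_fun_defect n R f :
  jet_fun n (fun j => R j *m toep_mx d (node j) 'X - toep_mx d t 'X *m R j) node f
  = jet_fun n R node ('X * f) - toep_mx d t 'X *m jet_fun n R node f.
Proof.
rewrite mulmx_sumr -sumrB; apply: eq_bigr => j _.
by rewrite mulmxBl jetM !mulmxA.
Qed.

(** The defect of P_(k+1) kills degree < dk because P_(k+1) kills degree < d(k+1), and so does
    M_(k+1) times the twist of P_k. Their difference involves only the k nodes t^(q^2), ...,
    t^(q^(k+1)), so [hermite_uniq] makes it zero. *)
Lemma twisted_prod_X k j :
  twisted_prod k.+1 j *m toep_mx d (node j) 'X = toep_mx d t 'X *m twisted_prod k.+1 j
   + (if j is i.+1 then conn_mx k.+1 *m map_mx phi (twisted_prod k i) else 0).
Proof.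
case: j => [|[|j]].
- by rewrite twisted_prod0 mul1mx mulmx1 addr0 node0.
- by rewrite [twisted_prod k 0]twisted_prod0 map_mx1 mulmx1 addrC subrK.
case: (leqP k j) => [le_kj|lt_jk].
  by rewrite !twisted_prod_gt ?map_mx0 ?mulmx0 ?mul0mx ?addr0 //; lia.
apply/eqP; rewrite addrC -subr_eq -subr_eq0; apply/eqP.
pose G i := twisted_prod k.+1 i *m toep_mx d (node i) 'X - toep_mx d t 'X *m twisted_prod k.+1 i.
have G00 : G 0%N = 0 by rewrite /G twisted_prod0 mul1mx mulmx1 node0 subrr.
(* The index starts at 2: the difference vanishes at node 0 as P has constant term 1, and at node 1
   by the definition of [conn_mx]. *)
pose R i := G i.+2 - conn_mx k.+1 *m map_mx phi (twisted_prod k i.+1).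
rewrite -[LHS]/(R j).
apply: (@hermite_uniq _ _ k R (fun i => node i.+2)) lt_jk.
  by move=> i1 i2 _ _ /node_inj; lia.
move=> f sf.
have := kills_twist (@twisted_prod_kills k) sf.
have G0 : jet_fun k.+2 G node f = 0.
  rewrite jet_fun_defect !twisted_prod_kills ?mulmx0 ?subrr //; first by nia.
  case: (posnP d) => [d0|d_gt0].
    by move: sf; rewrite d0 !mul0n leqn0 size_poly_eq0 => /eqP->; rewrite mulr0 size_poly0.
  by rewrite (leq_trans (size_polyMleq _ _)) // size_polyX; nia.
rewrite {1}/jet_fun big_ord_recl /= twisted_prod0 map_mx1 mul1mx => e.
have {}G0 : conn_mx k.+1 *m jet d (node 1) f
     + \sum_(i < k) G i.+2 *m jet d (node i.+2) f = 0.
  by rewrite -[RHS]G0 /jet_fun !big_ord_recl [G (ord0 : 'I_k.+2)]G00 mul0mx add0r.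
rewrite /jet_fun /R.
under eq_bigr => i _ do rewrite mulmxBl -mulmxA.
rewrite sumrB -mulmx_sumr -[X in X - _](addKr (conn_mx k.+1 *m jet d (node 1) f)) G0 addr0.
rewrite -opprD -mulmxDr; rewrite /= in e.
by under eq_bigr => i _ do [rewrite -[i.+1]/(bump 0 i)]; rewrite e mulmx0 oppr0.
Qed.

(** Apply the defect of P_(k+1) to f = [node_poly 2 k.+2] times (X - t^q)^(d-1-b), which isolates
    node 1. It equals P_(k+1)(X f), which is zero by degree unless b = 0. For b = 0, X f is monic of
    degree d(k+1), hence interchangeable with [node_poly 1 k.+2], whose only surviving jet is at
    t. *)
Lemma conn_mxE k : (0 < d)%N ->
  conn_mx k.+1 *m toep_mx d (node 1) (node_poly 2 k.+2)
  = toep_mx d t (node_poly 1 k.+2) *m e_d1mx.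
Proof.
move=> d_gt0; apply/matrixP => a b.
suff /matrixP/(_ a 0) : conn_mx k.+1 *m toep_mx d (node 1) (node_poly 2 k.+2) *m delta_mx b (0 : 'I_1)
   = toep_mx d t (node_poly 1 k.+2) *m e_d1mx *m delta_mx b 0 by rewrite -!colE !mxE.
rewrite -[RHS]mulmxA.
have -> : e_d1mx *m delta_mx b (0 : 'I_1) = (b == 0 :> nat)%:R *: jet d t 1.
  rewrite -colE; apply/matrixP => i c; rewrite !mxE -(expr0 ('X - t%:P)).
  rewrite nderivn_XsubCX_root -natrM mulnb andbC; congr (nat_of_bool (_ && _))%:R.
  by have := ltn_ord i; lia.
rewrite -[LHS]mulmxA -(jet_XsubCX (node 1)) -jetM.
set f := node_poly 2 _ * _.
have sf : size f = (d * k + (d - b)).-1.+1.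
  rewrite size_monicM ?node_poly_monic ?expf_neq0 ?polyXsubC_eq0 //.
  by rewrite size_node_poly size_exp_XsubC; have := ltn_ord b; nia.
pose G i := twisted_prod k.+1 i *m toep_mx d (node i) 'X - toep_mx d t 'X *m twisted_prod k.+1 i.
have G00 : G 0%N = 0 by rewrite /G twisted_prod0 mul1mx mulmx1 node0 subrr.
have <- : jet_fun k.+2 G node f = conn_mx k.+1 *m jet d (node 1) f.
  rewrite /jet_fun big_ord_recl [G (ord0 : 'I_k.+2)]G00 mul0mx add0r.
  rewrite big_ord_recl big1 ?addr0 // => i _.
  by rewrite jet_node_poly ?mulmx0 //= /bump /=; have := ltn_ord i; lia.
have kl := @twisted_prod_kills k.+1.
have := ltn_ord b => lt_bd.
rewrite jet_fun_defect [X in _ *m X]kl ?mulmx0 ?subr0; last by rewrite sf; nia.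
case: (eqVneq (b : nat) 0%N) => [b0|b_gt0]; last first.
  rewrite scale0r mulmx0 kl // (leq_trans (size_polyMleq _ _)) // size_polyX sf; nia.
have W1 : node_poly 1 k.+2 = node_poly 1 k.+2 * 1 by rewrite mulr1.
rewrite scale1r -jetM -(jet_fun_node_poly _ 1 (twisted_prod0 k.+1)) -W1.
apply: (kills_congr kl).
have fm : f \is monic by rewrite monicMl ?node_poly_monic ?monic_exp ?monicXsubC.
apply: size_monic_sub; first by rewrite monicMl ?monicX.
- exact: node_poly_monic.
- by rewrite mulrC size_mulX ?monic_neq0 // sf b0; nia.
- by rewrite size_node_poly subn1.
Qed.

End Interpolation.

(** * The matrices L_i *)

Section LocalRing.
Variables (E : fieldType) (x0 y0 z0 : E).
Implicit Types (f g : ratfun3 E) (p : {poly E}).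

Local Notation ev := (ratfun3_eval x0 y0 z0).
Local Notation ev3 := (poly3_eval x0 y0 z0).

Lemma poly3_evalD a b : ev3 (a + b) = ev3 a + ev3 b.
Proof. by rewrite /poly3_eval !hornerD. Qed.
Lemma poly3_evalM a b : ev3 (a * b) = ev3 a * ev3 b.
Proof. by rewrite /poly3_eval !hornerM. Qed.
Lemma poly3_evalN a : ev3 (- a) = - ev3 a.
Proof. by rewrite /poly3_eval !hornerN. Qed.
Lemma poly3_eval1 : ev3 1 = 1.
Proof. by rewrite /poly3_eval !hornerC. Qed.

Lemma poly3_eval_neq0 b : ev3 b != 0 -> b%:F != 0 :> ratfun3 E.
Proof. by rewrite tofrac_eq0; apply: contra_neq => ->; rewrite /poly3_eval !horner0. Qed.

(** The local ring at the point, on which [ratfun3_eval] is a ring morphism and its default value is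
    never taken. *)
Definition regular f := exists a b : poly3 E, ev3 b != 0 /\ f = a%:F / b%:F.

Lemma regular_tofrac a : regular a%:F.
Proof. by exists a, 1; rewrite poly3_eval1 oner_neq0 tofrac1 divr1. Qed.

Lemma ev_tofrac a : ev a%:F = ev3 a.
Proof.
have -> : a%:F = a%:F / 1%:F :> ratfun3 E by rewrite tofrac1 divr1.
by rewrite ratfun3_evalE poly3_eval1 ?oner_neq0 ?divr1.
Qed.

Lemma regularD f g : regular f -> regular g -> regular (f + g) /\ ev (f + g) = ev f + ev g.
Proof.
move=> [a [b [b0 ->]]] [a' [b' [b'0 ->]]].
have bb : ev3 (b * b') != 0 by rewrite poly3_evalM mulf_neq0.
have e : a%:F / b%:F + a'%:F / b'%:F = (a * b' + a' * b)%:F / (b * b')%:F :> ratfun3 E.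
  by rewrite addf_div ?poly3_eval_neq0 // tofracD !tofracM.
rewrite e; split; first by exists (a * b' + a' * b), (b * b').
by rewrite !ratfun3_evalE // poly3_evalD !poly3_evalM addf_div.
Qed.

Lemma regularM f g : regular f -> regular g -> regular (f * g) /\ ev (f * g) = ev f * ev g.
Proof.
move=> [a [b [b0 ->]]] [a' [b' [b'0 ->]]].
have bb : ev3 (b * b') != 0 by rewrite poly3_evalM mulf_neq0.
rewrite mulf_div -!tofracM; split; first by exists (a * a'), (b * b').
by rewrite !ratfun3_evalE // !poly3_evalM mulf_div.
Qed.

Lemma regularN f : regular f -> regular (- f).
Proof.
by move=> [a [b [b0 ->]]]; exists (- a), b; rewrite tofracN mulNr.
Qed.

Lemma regular_div f b : regular f -> ev3 b != 0 -> regular (f / b%:F).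
Proof.
move=> rf b0; apply: (proj1 (regularM rf _)).
by exists 1, b; rewrite tofrac1 mul1r.
Qed.

Lemma regular_sum (I : Type) (r : seq I) (P : pred I) (f : I -> ratfun3 E) :
  (forall i, regular (f i)) ->
  regular (\sum_(i <- r | P i) f i)
  /\ ev (\sum_(i <- r | P i) f i) = \sum_(i <- r | P i) ev (f i).
Proof.
move=> rf; elim: r => [|i r [IH1 IH2]].
  rewrite !big_nil -tofrac0 ev_tofrac; split; first exact: regular_tofrac.
  by rewrite /poly3_eval !horner0.
rewrite !big_cons; case: ifP => // _.
by have [? ->] := regularD (rf i) IH1; rewrite IH2.
Qed.

Lemma regularMn f n : regular f -> regular (f *+ n) /\ ev (f *+ n) = ev f *+ n.
Proof.
move=> rf; elim: n => [|n [IH1 IH2]].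
  rewrite !mulr0n -tofrac0 ev_tofrac; split; first exact: regular_tofrac.
  by rewrite /poly3_eval !horner0.
by rewrite !mulrS; have [? ->] := regularD rf IH1; rewrite IH2.
Qed.

Lemma regularX f n : regular f -> regular (f ^+ n) /\ ev (f ^+ n) = ev f ^+ n.
Proof.
move=> rf; elim: n => [|n [IH1 IH2]].
  by rewrite !expr0 -tofrac1 ev_tofrac poly3_eval1; split=> //; apply: regular_tofrac.
by rewrite !exprS; have [? ->] := regularM rf IH1; rewrite IH2.
Qed.

(** The Leibniz rule for a = f b, solved for its top term, gives D_j f from the lower terms with the
    same denominator b. *)
Lemma regular_hasse (D : nat -> poly3 E -> poly3 E) j f : hasse_schmidt D ->
  regular f -> regular (hasse_frac D j f).
Proof.
move=> HD [a [b [b0 fE]]].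
have bn : b != 0 by rewrite -(tofrac_eq0 b) poly3_eval_neq0.
elim/ltn_ind: j => j IH.
have -> : hasse_frac D j f = ((D j a)%:F
    - \sum_(k < j) hasse_frac D k f * (D (j - k)%N b)%:F) / b%:F.
  apply: (mulIf (poly3_eval_neq0 b0)); rewrite divfK ?poly3_eval_neq0 //.
  rewrite -(hasse_frac_mulE HD bn fE j) big_ord_recr /= subnn (hs0 HD).
  by rewrite addrAC subrr add0r.
apply: regular_div => //; apply: (proj1 (regularD _ _)); first exact: regular_tofrac.
apply: regularN; elim/big_rec: _ => [|k g _ rg].
  by rewrite -tofrac0; apply: regular_tofrac.
apply: (proj1 (regularD _ _)) => //; apply: (proj1 (regularM _ _)); first exact: IH.
exact: regular_tofrac.
Qed.

Lemma regular_hasse_x j f : regular f -> regular (hasse_x j f).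
Proof. exact/regular_hasse/nderivn_hasse_schmidt. Qed.

Lemma regular_hasse_z j f : regular f -> regular (hasse_z j f).
Proof. exact/regular_hasse/map_nderivn_hasse_schmidt. Qed.

Definition in_x p : ratfun3 E := (map_poly (polyC \o polyC) p)%:F.
Definition in_z p : ratfun3 E := ((map_poly polyC p)%:P)%:F.

Lemma hasse_x_in_x j p : hasse_x j (in_x p) = in_x p^`N(j).
Proof.
rewrite /hasse_x hasse_frac_tofrac ?nderivn_map //.
exact: nderivn_hasse_schmidt.
Qed.

Lemma hasse_z_in_z j p : hasse_z j (in_z p) = in_z p^`N(j).
Proof.
rewrite /hasse_z hasse_frac_tofrac; last exact: map_nderivn_hasse_schmidt.
congr tofrac; apply/polyP => k; rewrite coef_map_id0 ?raddf0 // !coefC.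
by case: eqP; rewrite ?raddf0 // nderivn_map.
Qed.

Lemma hasse_x_const (c : {poly {poly E}}) : hs_const (@hasse_x E) (c%:P)%:F.
Proof.
case=> // j _; rewrite /hasse_x hasse_frac_tofrac ?nderivnC ?tofrac0 //.
exact: nderivn_hasse_schmidt.
Qed.

Lemma hasse_z_const (p : {poly {poly E}}) :
  hs_const (@hasse_z E) (map_poly polyC p)%:F.
Proof.
case=> // j _; rewrite /hasse_z hasse_frac_tofrac; last exact: map_nderivn_hasse_schmidt.
rewrite -[RHS]tofrac0; congr tofrac; apply/polyP => k.
by rewrite coef_map_id0 ?raddf0 // coef_map /= nderivnC coef0.
Qed.

Lemma hasse_z_in_x p : hs_const (@hasse_z E) (in_x p).
Proof. by rewrite /in_x map_poly_comp; apply: hasse_z_const. Qed.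

Lemma ev_in_x p : ev (in_x p) = p.[x0].
Proof.
rewrite ev_tofrac /poly3_eval (_ : x0%:P%:P = (polyC \o polyC) x0) //.
by rewrite horner_map /= !hornerC.
Qed.

Lemma ev_in_z p : ev (in_z p) = p.[z0].
Proof. by rewrite ev_tofrac /poly3_eval hornerC horner_map /= hornerC. Qed.

Lemma in_x_XsubC c : in_x ('X - c%:P) = rf_x E - rf_cst c.
Proof. by rewrite /in_x rmorphB /= map_polyX map_polyC tofracB. Qed.

Lemma in_z_XsubC c : in_z ('X - c%:P) = rf_z E - rf_cst c.
Proof. by rewrite /in_z rmorphB /= map_polyX map_polyC /= polyCB tofracB. Qed.

Lemma in_xM p p' : in_x (p * p') = in_x p * in_x p'.
Proof. by rewrite /in_x rmorphM tofracM. Qed.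
Lemma in_zM p p' : in_z (p * p') = in_z p * in_z p'.
Proof. by rewrite /in_z rmorphM polyCM tofracM. Qed.
Lemma in_x1 : in_x 1 = 1.
Proof. by rewrite /in_x rmorph1 tofrac1. Qed.
Lemma in_z1 : in_z 1 = 1.
Proof. by rewrite /in_z rmorph1 polyC1 tofrac1. Qed.

Lemma in_x_prod (r : seq nat) (c : nat -> E) d :
  (\prod_(k <- r) (rf_x E - rf_cst (c k))) ^+ d = in_x (\prod_(k <- r) ('X - (c k)%:P) ^+ d).
Proof.
rewrite -prodrXl; elim/big_rec2: _ => [|k a b _ ->]; rewrite ?in_x1 // in_xM.
congr (_ * _); elim: d => [|d IH]; first by rewrite !expr0 in_x1.
by rewrite !exprS in_xM IH in_x_XsubC.
Qed.

Lemma in_z_prod (r : seq nat) (c : nat -> E) d :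
  (\prod_(k <- r) (rf_z E - rf_cst (c k))) ^+ d = in_z (\prod_(k <- r) ('X - (c k)%:P) ^+ d).
Proof.
rewrite -prodrXl; elim/big_rec2: _ => [|k a b _ ->]; rewrite ?in_z1 // in_zM.
congr (_ * _); elim: d => [|d IH]; first by rewrite !expr0 in_z1.
by rewrite !exprS in_zM IH in_z_XsubC.
Qed.

Variable d : nat.

(** Rows record the derivatives in x, so by Leibniz a factor depending on x alone acts as a Toeplitz
    matrix on the left; the z-derivatives treat it as a constant. *)
Lemma eval_Delta_Ml u h : regular h ->
  map_mx ev (Delta d (in_x u * h)) = toep_mx d x0 u *m map_mx ev (Delta d h).
Proof.
move=> rh; apply/matrixP => i j; rewrite !mxE.
under [RHS]eq_bigr => k _ do rewrite !mxE.
rewrite (hs_constM (@hasse_z_hasse_schmidt E)); last exact: hasse_z_in_x.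
rewrite (hsM (@hasse_x_hasse_schmidt E)).
have rt l : regular (hasse_x l (hasse_z j h)) by apply/regular_hasse_x/regular_hasse_z.
have ri p : regular (in_x p) by apply: regular_tofrac.
have rp l k : regular (hasse_x l (in_x u) * hasse_x k (hasse_z j h)).
  by rewrite hasse_x_in_x; apply: (proj1 (regularM _ _)).
rewrite (proj2 (regular_sum _ _ _)); last by move=> l; apply: rp.
rewrite -(big_mkord xpredT (fun l => ev (hasse_x l (in_x u) * hasse_x (d - i.+1 - l) (hasse_z j h)))).
rewrite -(big_mkord xpredT (fun k : nat => (if (i <= k)%N then u^`N(k - i).[x0] else 0)
   * ev (hasse_x (d - k.+1) (hasse_z j h)))).
rewrite [RHS](big_cat_nat (leq0n i)) ?(ltnW (ltn_ord i)) //=.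
rewrite [X in _ = X + _]big_nat [X in _ = X + _]big1 ?add0r => [|k /andP[_ lt_ki]]; last first.
  by rewrite leqNgt lt_ki mul0r.
rewrite [RHS](big_addn 0 _ i) subnSK //.
apply: eq_bigr => k _.
rewrite (proj2 (regularM _ _)) ?hasse_x_in_x // ev_in_x leq_addl addnK -subnDA.
by congr (_ * ev (hasse_x _ _)); lia.
Qed.

(** Columns record the derivatives in z, so a factor depending on z alone acts on the right. *)
Lemma eval_Delta_Mr v h : regular h ->
  map_mx ev (Delta d (h * in_z v)) = map_mx ev (Delta d h) *m toep_mx d z0 v.
Proof.
move=> rh; apply/matrixP => i j; rewrite !mxE.
under [RHS]eq_bigr => k _ do rewrite !mxE.
rewrite (hsM (@hasse_z_hasse_schmidt E)) (hs_sum (@hasse_x_hasse_schmidt E)).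
have rt l : regular (hasse_x (d - i.+1) (hasse_z l h)) by apply/regular_hasse_x/regular_hasse_z.
have ri p : regular (in_z p) by apply: regular_tofrac.
have e (k : nat) : hasse_x (d - i.+1) (hasse_z k h * hasse_z (j - k) (in_z v))
    = in_z v^`N(j - k) * hasse_x (d - i.+1) (hasse_z k h).
  by rewrite hasse_z_in_z mulrC (hs_constM (@hasse_x_hasse_schmidt E)) //; apply: hasse_x_const.
under [X in ev X]eq_bigr => k _ do rewrite e.
rewrite (proj2 (regular_sum _ _ _)); last by move=> l; apply: (proj1 (regularM _ _)).
rewrite -(big_mkord xpredT (fun k => ev (in_z v^`N(j - k) * hasse_x (d - i.+1) (hasse_z k h)))).
rewrite -(big_mkord xpredT (fun k : nat => ev (hasse_x (d - i.+1) (hasse_z k h))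
   * (if (k <= j)%N then v^`N(j - k).[z0] else 0))).
rewrite [RHS](big_cat_nat (n:=j.+1)) //=.
rewrite [X in _ = _ + X]big_nat [X in _ = _ + X]big1 ?addr0 => [|k /andP[lt_jk _]]; last first.
  by rewrite leqNgt lt_jk mulr0.
rewrite big_nat [RHS]big_nat; apply: eq_bigr => k /andP[_ le_kj].
by rewrite (proj2 (regularM _ _)) // ev_in_z -ltnS le_kj mulrC.
Qed.

Lemma eval_Delta_f_poly (i j : 'I_d) :
  map_mx ev (Delta d (f_poly d (rf_x E) (rf_y E) (rf_z E))) i j
  = jet d x0 (\sum_(m < d) ((z0 - y0) ^+ (m - j) *+ 'C(m, j)) *: ('X - y0%:P) ^+ (d - m.+1)) i 0.
Proof.
have HX := @hasse_x_hasse_schmidt E; have HZ := @hasse_z_hasse_schmidt E.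
have y_z k : (0 < k)%N -> hasse_z k (rf_y E) = 0.
  move=> k0; rewrite /rf_y -(map_polyC (polyC : {rmorphism _ -> _})).
  exact: hasse_z_const.
have y_x k : (0 < k)%N -> hasse_x k (rf_y E) = 0 by apply: hasse_x_const.
have x_z : hs_const (@hasse_z E) (rf_x E).
  by rewrite /rf_x -(map_polyX (polyC : {rmorphism _ -> _})); apply: hasse_z_const.
have z_x : hs_const (@hasse_x E) (rf_z E) by apply: hasse_x_const.
have rx : regular (rf_x E) by apply: regular_tofrac.
have ry : regular (rf_y E) by apply: regular_tofrac.
have rz : regular (rf_z E) by apply: regular_tofrac.
have [rxy exy] : regular (rf_x E - rf_y E) /\ ev (rf_x E - rf_y E) = x0 - y0.
  rewrite -tofracB ev_tofrac poly3_evalD poly3_evalN /poly3_eval !(hornerX, hornerC).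
  by split=> //; apply: regular_tofrac.
have [rzy ezy] : regular (rf_z E - rf_y E) /\ ev (rf_z E - rf_y E) = z0 - y0.
  rewrite -tofracB ev_tofrac poly3_evalD poly3_evalN /poly3_eval !(hornerX, hornerC).
  by split=> //; apply: regular_tofrac.
have dx k m : hasse_x k ((rf_x E - rf_y E) ^+ m) = (rf_x E - rf_y E) ^+ (m - k) *+ 'C(m, k).
  have xn l : hasse_x l (rf_x E) = rf_x E ^+ (1 - l) *+ 'C(1, l).
    by rewrite -hasse_x_xn expr1.
  apply: (hs_varX HX) => [|l l1]; rewrite (hsD HX) (hsN HX) y_x ?(ltnW l1) // subr0 xn //.
  by rewrite bin_small.
have dz k m : hasse_z k ((rf_z E - rf_y E) ^+ m) = (rf_z E - rf_y E) ^+ (m - k) *+ 'C(m, k).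
  have zn l : hasse_z l (rf_z E) = rf_z E ^+ (1 - l) *+ 'C(1, l).
    by rewrite -hasse_z_zn expr1.
  apply: (hs_varX HZ) => [|l l1]; rewrite (hsD HZ) (hsN HZ) y_z ?(ltnW l1) // subr0 zn //.
  by rewrite bin_small.
rewrite !mxE /f_poly (hs_sum HZ) (hs_sum HX) raddf_sum horner_sum /=.
have e m : hasse_x (d - i.+1) (hasse_z j ((rf_z E - rf_y E) ^+ m * (rf_x E - rf_y E) ^+ (d - 1 - m)))
   = ((rf_z E - rf_y E) ^+ (m - j) *+ 'C(m, j))
     * ((rf_x E - rf_y E) ^+ (d - m.+1 - (d - i.+1)) *+ 'C(d - m.+1, d - i.+1)).
  rewrite mulrC -subnDA add1n (hs_constM HZ); last exact/hs_constX/hs_constB.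
  rewrite dz mulrC (hs_constM HX) ?dx //.
  exact/hs_constMn/hs_constX/hs_constB.
have r1 m k : regular ((rf_z E - rf_y E) ^+ m *+ k).
  by apply: (proj1 (regularMn _ _)); apply: (proj1 (regularX _ _)).
have r2 m k : regular ((rf_x E - rf_y E) ^+ m *+ k).
  by apply: (proj1 (regularMn _ _)); apply: (proj1 (regularX _ _)).
under eq_bigr => m _ do rewrite e.
rewrite (proj2 (regular_sum _ _ _)); last by move=> m; apply: (proj1 (regularM _ _)).
apply: eq_bigr => m _; rewrite (proj2 (regularM _ _)) //.
have eX f n k : regular f -> ev (f ^+ n *+ k) = ev f ^+ n *+ k.
  by move=> rf; have [rX <-] := regularX n rf; rewrite (proj2 (regularMn k rX)).
by rewrite !eX // exy ezy nderivnZ hornerZ nderivn_XsubCX hornerMn horner_exp hornerXsubC.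
Qed.

End LocalRing.

Lemma theta_node_inj (F : finFieldType) : injective (node #|F| (theta F)).
Proof.
move=> i j; rewrite /node /theta -!rmorphXn => /eqP; rewrite tofrac_eq => /eqP.
move=> /(congr1 (fun p : {poly F} => size p)); rewrite !size_polyXn => -[].
exact/expnI/card_finNzRing_gt1.
Qed.

Lemma Lmx_factor (F : finFieldType) d i :
  Lmx F d i *m toep_mx d (node #|F| (theta F) 1) (node_poly d #|F| (theta F) 2 i.+2)
  = toep_mx d (theta F) (node_poly d #|F| (theta F) 1 i.+1) *m bmx d #|F| (theta F) i.
Proof.
set t := theta F; set q := #|F|; set v := node_poly _ _ _ 2 _; set u := node_poly _ _ _ 1 _.
rewrite /Lmx -/t -/q.
have e1 : t ^+ q = node q t 1 by rewrite /node expn1.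
rewrite e1; set ev := ratfun3_eval _ _ _; rewrite expr_div_n.
rewrite (in_x_prod (index_iota 1 i.+1) (node q t)) (in_z_prod (index_iota 2 i.+2) (node q t)).
rewrite -/u -/v; set fp := f_poly _ _ _ _; set h := fp * _.
have vz : v.[node q t 1] != 0.
  rewrite horner_prod prodf_seq_neq0; apply/allP => k; rewrite mem_index_iota => /andP[k2 _].
  rewrite /= horner_exp hornerXsubC expf_neq0 // subr_eq0; apply: contraTneq k2.
  by move=> /theta_node_inj <-.
have rfp : regular t (node q t i.+1) (node q t 1) fp.
  rewrite /fp /f_poly; apply: (proj1 (regular_sum _ _ _)) => m.
  have r (a b : poly3 {fraction {poly F}}) n : regular t (node q t i.+1) (node q t 1) ((a%:F - b%:F) ^+ n).
    by apply: (proj1 (regularX _ _)); rewrite -tofracB; apply: regular_tofrac.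
  by apply: (proj1 (regularM _ _)); apply: r.
have ri p : regular t (node q t i.+1) (node q t 1) (in_x p) by apply: regular_tofrac.
have vz3 : poly3_eval t (node q t i.+1) (node q t 1) (map_poly polyC v)%:P != 0.
  by rewrite -ev_tofrac ev_in_z.
(* The denominator depends only on z and the product in the numerator only on x, so the two
   multiplication rules separate them from f_d. *)
have hv : h * in_z v = in_x u * fp.
  rewrite /h -mulrA divfK ?[_ * fp]mulrC //.
  exact: (poly3_eval_neq0 vz3).
have rh : regular t (node q t i.+1) (node q t 1) h.
  by rewrite /h mulrA; apply: regular_div => //; apply: (proj1 (regularM _ _)).
rewrite -eval_Delta_Mr // hv eval_Delta_Ml //; congr (_ *m _).
by apply/matrixP => a b; rewrite eval_Delta_f_poly [RHS]mxE.
Qed.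

(** * Ultrametric analysis *)

Section Ultrametric.
Variables (F : finFieldType) (R : realType) (C : fieldType).
Variables (iota : {rmorphism {fraction {poly F}} -> C}) (abs : C -> R).
Hypothesis hC : is_Cinfty iota abs.

Let abs_ge0 := Cinfty_abs_ge0 hC.
Let abs_eq0 := Cinfty_abs_eq0 hC.
Let absM := Cinfty_absM hC.
Let absD := Cinfty_absD hC.

Lemma abs0 : abs 0 = 0. Proof. exact/abs_eq0. Qed.

Lemma abs_gt0 x : x != 0 -> 0 < abs x.
Proof. by move=> x0; rewrite lt_def abs_ge0 andbT; apply: contra_neq x0 => /abs_eq0. Qed.

Lemma abs1 : abs 1 = 1.
Proof.
by apply: (mulIf (lt0r_neq0 (abs_gt0 (oner_neq0 C)))); rewrite -absM !mul1r.
Qed.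

Lemma absX x n : abs (x ^+ n) = abs x ^+ n.
Proof. by elim: n => [|n IH]; rewrite ?expr0 ?abs1 // !exprS absM IH. Qed.

Lemma absN x : abs (- x) = abs x.
Proof.
rewrite -mulN1r absM; suff -> : abs (-1) = 1 by rewrite mul1r.
by apply: (@pexpIrn _ 2) => //; rewrite ?nnegrE ?abs_ge0 // -absX sqrrN !expr1n abs1.
Qed.

Lemma absBC x y : abs (x - y) = abs (y - x).
Proof. by rewrite -absN opprB. Qed.

Lemma absV x : abs x^-1 = (abs x)^-1.
Proof.
case: (eqVneq x 0) => [->|x0]; first by rewrite invr0 abs0 invr0.
apply: (mulIf (lt0r_neq0 (abs_gt0 x0))).
by rewrite -absM !mulVf ?abs1 // lt0r_neq0 ?abs_gt0.
Qed.

Lemma absD_le x y B : abs x <= B -> abs y <= B -> abs (x + y) <= B.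
Proof. by move=> hx hy; rewrite (le_trans (absD _ _)) // ge_max hx. Qed.

Lemma absD_lt x y B : abs x < B -> abs y < B -> abs (x + y) < B.
Proof. by move=> hx hy; rewrite (le_lt_trans (absD _ _)) // gt_max hx. Qed.

Lemma absB_le x y B : abs x <= B -> abs y <= B -> abs (x - y) <= B.
Proof. by move=> hx hy; rewrite absD_le ?absN. Qed.

Lemma absB_lt x y B : abs x < B -> abs y < B -> abs (x - y) < B.
Proof. by move=> hx hy; rewrite absD_lt ?absN. Qed.

Lemma abs_addl x y : abs y < abs x -> abs (x + y) = abs x.
Proof.
move=> lt_yx; apply/eqP; rewrite eq_le absD_le ?(ltW lt_yx) //=.
rewrite leNgt; apply/negP => h.
by have := absB_lt h lt_yx; rewrite addrK ltxx.
Qed.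

Lemma abs_sum_le (I : Type) (r : seq I) (P : pred I) (f : I -> C) B : 0 <= B ->
  (forall i, P i -> abs (f i) <= B) -> abs (\sum_(i <- r | P i) f i) <= B.
Proof.
by move=> B0 h; elim/big_ind: _ => [|x y|//]; rewrite ?abs0 //; apply: absD_le.
Qed.

Lemma abs_sum_lt (I : Type) (r : seq I) (P : pred I) (f : I -> C) B : 0 < B ->
  (forall i, P i -> abs (f i) < B) -> abs (\sum_(i <- r | P i) f i) < B.
Proof.
by move=> B0 h; elim/big_ind: _ => [|x y|//]; rewrite ?abs0 //; apply: absD_lt.
Qed.

Lemma abs_prod_le1 (I : Type) (r : seq I) (P : pred I) (f : I -> C) :
  (forall i, P i -> abs (f i) <= 1) -> abs (\prod_(i <- r | P i) f i) <= 1.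
Proof.
move=> h; elim/big_ind: _ => [|x y hx hy|//]; first by rewrite abs1.
by rewrite absM mulr_ile1.
Qed.

Lemma abs_prod1 (I : Type) (r : seq I) (P : pred I) (f : I -> C) :
  (forall i, P i -> abs (f i) = 1) -> abs (\prod_(i <- r | P i) f i) = 1.
Proof.
move=> h; elim/big_ind: _ => [|x y hx hy|//]; first by rewrite abs1.
by rewrite absM hx hy mulr1.
Qed.

Lemma abs_mulrn x n : abs (x *+ n) <= abs x.
Proof. by elim: n => [|n IH]; rewrite ?mulr0n ?abs0 // mulrS absD_le. Qed.

Lemma abs_cvgP (u : nat -> C) l : abs_cvg abs u l <->
  forall e : R, 0 < e -> exists n0, forall n, (n0 <= n)%N -> abs (u n - l) < e.
Proof.
split=> [/cvgrPdist_lt h e e0|h].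
  have [n0 _ hn] := h e e0; exists n0 => n /hn.
  by rewrite /= sub0r normrN ger0_norm.
apply/cvgrPdist_lt => e e0; have [n0 hn] := h e e0; exists n0 => // n /hn.
by rewrite /= sub0r normrN ger0_norm.
Qed.

Lemma abs_cvg_uniq u l l' : abs_cvg abs u l -> abs_cvg abs u l' -> l = l'.
Proof.
move=> /abs_cvgP h /abs_cvgP h'; apply/eqP; rewrite -subr_eq0; apply/eqP.
apply/abs_eq0/eqP; rewrite eq_le abs_ge0 andbT leNgt; apply/negP => e0.
have [n hn] := h _ e0; have [n' hn'] := h' _ e0.
have := absB_lt (hn' _ (leq_maxr n n')) (hn _ (leq_maxl n n')).
by rewrite opprB addrC addrA subrK ltxx.
Qed.

Lemma abs_cvg_eq u v l : u =1 v -> abs_cvg abs u l -> abs_cvg abs v l.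
Proof.
by move=> uv /abs_cvgP h; apply/abs_cvgP => e /h[n hn]; exists n => k; rewrite -uv; apply: hn.
Qed.

Lemma abs_cvg_cst c : abs_cvg abs (fun=> c) c.
Proof. by apply/abs_cvgP => e e0; exists 0%N => n _; rewrite subrr abs0. Qed.

Lemma abs_cvgD u v l m : abs_cvg abs u l -> abs_cvg abs v m ->
  abs_cvg abs (fun n => u n + v n) (l + m).
Proof.
move=> /abs_cvgP hu /abs_cvgP hv; apply/abs_cvgP => e e0.
have [n hn] := hu _ e0; have [n' hn'] := hv _ e0.
exists (maxn n n') => k; rewrite geq_max => /andP[/hn h1 /hn' h2].
by rewrite opprD addrACA absD_lt.
Qed.

Lemma abs_cvg_bounded u l : abs_cvg abs u l -> exists2 B : R, 0 < B &
  exists n0, forall n, (n0 <= n)%N -> abs (u n) <= B.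
Proof.
move=> /abs_cvgP h; have [n0 hn] := h 1 ltr01.
exists (Num.max (abs l) 1); first by rewrite lt_max ltr01 orbT.
exists n0 => n /hn h1; rewrite -[u n](subrK l) absD_le // le_max ?lexx ?(ltW h1) ?orbT //.
Qed.

Lemma abs_cvg0_bounded u v B : abs_cvg abs u 0 -> (forall n, abs (v n) <= B) ->
  abs_cvg abs (fun n => u n * v n) 0.
Proof.
move=> /abs_cvgP hu hv; apply/abs_cvgP => e e0.
have B0 : 0 <= B := le_trans (abs_ge0 _) (hv 0%N).
have B1 : 0 < B + 1 by rewrite ltr_wpDl.
have [n hn] := hu (e / (B + 1)) (divr_gt0 e0 B1); exists n => k /hn.
rewrite !subr0 absM => h; apply: le_lt_trans (_ : abs (u k) * (B + 1) < e).
  by rewrite ler_wpM2l // (le_trans (hv k)) // lerDl.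
by rewrite -ltr_pdivlMr.
Qed.

Lemma abs_cvgM u v l m : abs_cvg abs u l -> abs_cvg abs v m ->
  abs_cvg abs (fun n => u n * v n) (l * m).
Proof.
move=> hu hv; have [B B0 [n0 hB]] := abs_cvg_bounded hu.
move/abs_cvgP: hu => hu; move/abs_cvgP: hv => hv; apply/abs_cvgP => e e0.
have m1 : 0 < abs m + 1 by rewrite ltr_wpDl.
have [n hn] := hu (e / (abs m + 1)) (divr_gt0 e0 m1).
have [n' hn'] := hv (e / B) (divr_gt0 e0 B0).
exists (maxn n0 (maxn n n')) => k; rewrite !geq_max => /and3P[/hB h0 /hn h1 /hn' h2].
have -> : u k * v k - l * m = u k * (v k - m) + (u k - l) * m by ring.
apply: absD_lt; rewrite absM.
  apply: le_lt_trans (_ : B * abs (v k - m) < e); first by rewrite ler_wpM2r.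
  by rewrite mulrC -ltr_pdivlMr.
apply: le_lt_trans (_ : abs (u k - l) * (abs m + 1) < e).
  by rewrite ler_wpM2l // lerDl.
by rewrite -ltr_pdivlMr.
Qed.

Lemma abs_cvgN u l : abs_cvg abs u l -> abs_cvg abs (fun n => - u n) (- l).
Proof.
move=> hu; rewrite -mulN1r; apply: abs_cvg_eq (abs_cvgM (abs_cvg_cst (-1)) hu) => n.
by rewrite mulN1r.
Qed.

Lemma abs_cvgX u l n : abs_cvg abs u l -> abs_cvg abs (fun k => u k ^+ n) (l ^+ n).
Proof.
move=> hu; elim: n => [|n IH]; first exact: abs_cvg_cst.
by rewrite exprS; apply: abs_cvg_eq (abs_cvgM hu IH) => k; rewrite exprS.
Qed.

Lemma abs_cvg_sum (I : Type) (r : seq I) (P : pred I) (u : I -> nat -> C) (l : I -> C) :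
  (forall i, P i -> abs_cvg abs (u i) (l i)) ->
  abs_cvg abs (fun n => \sum_(i <- r | P i) u i n) (\sum_(i <- r | P i) l i).
Proof.
move=> h; elim: r => [|i r IH].
  by rewrite big_nil; apply: abs_cvg_eq (abs_cvg_cst 0) => n; rewrite big_nil.
rewrite big_cons; case: ifP => [Pi|nPi]; last first.
  by apply: abs_cvg_eq IH => n; rewrite big_cons nPi.
by apply: abs_cvg_eq (abs_cvgD (h i Pi) IH) => n; rewrite big_cons Pi.
Qed.

Lemma abs_cvg_shift u l k : abs_cvg abs u l <-> abs_cvg abs (fun n => u (n + k)%N) l.
Proof.
split=> /abs_cvgP h; apply/abs_cvgP => e /h[n0 hn].
  by exists n0 => n le_n; apply: hn; rewrite (leq_trans le_n) // leq_addr.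
exists (n0 + k)%N => n le_n; have le_kn : (k <= n)%N by lia.
by rewrite -(subnK le_kn); apply: hn; lia.
Qed.

Lemma abs_cvg_le u l B : (forall n, abs (u n) <= B) -> abs_cvg abs u l -> abs l <= B.
Proof.
move=> hB /abs_cvgP h; rewrite leNgt; apply/negP => lt_Bl.
have B0 : 0 <= B := le_trans (abs_ge0 _) (hB 0%N).
have [n hn] := h _ (le_lt_trans B0 lt_Bl).
have := absB_lt (le_lt_trans (hB n) lt_Bl) (hn n (leqnn n)).
by rewrite opprB addrC subrK ltxx.
Qed.

Lemma abs_cvg_norm u l B : 0 < B -> (forall n, abs (u n) = B) -> abs_cvg abs u l -> abs l = B.
Proof.
move=> B0 hB /abs_cvgP/(_ B B0)[n hn].
rewrite -(hB n) -[u n in RHS](subrK l) addrC [RHS]abs_addl //.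
have le_l : B <= abs l.
  rewrite leNgt; apply/negP => h; have := absD_lt (hn n (leqnn n)) h.
  by rewrite subrK hB ltxx.
exact: lt_le_trans (hn n (leqnn n)) le_l.
Qed.

(** By the ultrametric inequality, increments tending to 0 already make the sequence Cauchy. *)
Lemma abs_cvg_series u : abs_cvg abs (fun n => u n.+1 - u n) 0 ->
  exists l, abs_cvg abs u l.
Proof.
move=> /abs_cvgP h; apply: (Cinfty_complete hC) => e e0.
have [n0 hn] := h e e0; exists n0.
have le k : abs (u (n0 + k)%N - u n0) < e.
  elim: k => [|k IH]; first by rewrite addn0 subrr abs0.
  have := hn (n0 + k)%N (leq_addr _ _); rewrite subr0 => h1.
  by rewrite addnS -(subrKA (u (n0 + k)%N)) absD_lt.
move=> m n /subnKC<- /subnKC<-.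
by rewrite -(subrKA (u n0)); apply: absD_lt => //; rewrite absBC.
Qed.

(** * Entrywise bounds and convergence of matrices *)

Section Matrices.
Implicit Types m n p : nat.

Definition mx_le m n (M : 'M[C]_(m, n)) (B : R) := forall i j, abs (M i j) <= B.

Lemma mx_leM m n p (M : 'M[C]_(m, n)) (N : 'M[C]_(n, p)) A B :
  mx_le M A -> mx_le N B -> 0 <= A -> 0 <= B -> mx_le (M *m N) (A * B).
Proof.
move=> hM hN A0 B0 i j; rewrite mxE abs_sum_le ?mulr_ge0 // => k _.
by rewrite absM ler_pM.
Qed.

Lemma mx_leB m n (M N : 'M[C]_(m, n)) B : mx_le M B -> mx_le N B -> mx_le (M - N) B.
Proof. by move=> hM hN i j; rewrite !mxE absB_le. Qed.

Lemma det_le1 n (M : 'M[C]_n) : mx_le M 1 -> abs (\det M) <= 1.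
Proof.
move=> hM; rewrite abs_sum_le // => s _; rewrite absM mulr_ile1 //.
  by rewrite absX absN abs1 expr1n.
by apply: abs_prod_le1.
Qed.

(** The inverse is the adjugate over a determinant of absolute value 1, and cofactors are
    determinants of integral matrices. *)
Lemma invmx_le1 n (M : 'M[C]_n) : mx_le M 1 -> abs (\det M) = 1 ->
  M \in unitmx /\ mx_le (invmx M) 1.
Proof.
move=> hM dM.
have uM : M \in unitmx.
  by rewrite unitmxE unitfE; apply/eqP => d0; move: dM; rewrite d0 abs0 => /eqP; rewrite eq_sym oner_eq0.
split=> // i j; rewrite /invmx uM !mxE absM absV dM invr1 mul1r absM.
rewrite absX absN abs1 expr1n mul1r.
by apply: det_le1 => a b; rewrite !mxE.
Qed.

Lemma mx_cvgM m n p (M : nat -> 'M[C]_(m, n)) (N : nat -> 'M[C]_(n, p)) M0 N0 :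
  mx_cvg abs M M0 -> mx_cvg abs N N0 -> mx_cvg abs (fun k => M k *m N k) (M0 *m N0).
Proof.
move=> hM hN i j; rewrite mxE.
have := abs_cvg_sum (index_enum 'I_n) (P := xpredT) (fun k _ => abs_cvgM (hM i k) (hN k j)).
by apply: abs_cvg_eq => k; rewrite mxE.
Qed.

Lemma mx_cvgD m n (M N : nat -> 'M[C]_(m, n)) M0 N0 :
  mx_cvg abs M M0 -> mx_cvg abs N N0 -> mx_cvg abs (fun k => M k + N k) (M0 + N0).
Proof.
by move=> hM hN i j; rewrite mxE; apply: abs_cvg_eq (abs_cvgD (hM i j) (hN i j)) => k; rewrite mxE.
Qed.

Lemma mx_cvg_cst m n (M : 'M[C]_(m, n)) : mx_cvg abs (fun=> M) M.
Proof. by move=> i j; apply: abs_cvg_cst. Qed.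

Lemma mx_cvgB m n (M N : nat -> 'M[C]_(m, n)) M0 N0 :
  mx_cvg abs M M0 -> mx_cvg abs N N0 -> mx_cvg abs (fun k => M k - N k) (M0 - N0).
Proof.
move=> hM hN i j; rewrite !mxE.
by apply: abs_cvg_eq (abs_cvgD (hM i j) (abs_cvgN (hN i j))) => k; rewrite !mxE.
Qed.

Lemma mx_cvg_uniq m n (M : nat -> 'M[C]_(m, n)) A B :
  mx_cvg abs M A -> mx_cvg abs M B -> A = B.
Proof. by move=> hA hB; apply/matrixP => i j; apply: abs_cvg_uniq (hA i j) (hB i j). Qed.

Lemma mx_cvg_eq m n (M N : nat -> 'M[C]_(m, n)) A : M =1 N -> mx_cvg abs M A -> mx_cvg abs N A.
Proof. by move=> e h i j; apply: abs_cvg_eq (h i j) => k; rewrite e. Qed.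

Lemma mx_cvg_shift m n (M : nat -> 'M[C]_(m, n)) A k :
  mx_cvg abs M A <-> mx_cvg abs (fun n => M (n + k)%N) A.
Proof.
by split=> h i j; apply/(abs_cvg_shift (fun n => M n i j) _ k); apply: h.
Qed.

Lemma mx_cvg_series m n (M : nat -> 'M[C]_(m, n)) :
  mx_cvg abs (fun k => M k.+1 - M k) 0 -> exists A, mx_cvg abs M A.
Proof.
move=> h; have /choice[A hA] (ij : 'I_m * 'I_n) :
    exists l, abs_cvg abs (fun k => M k ij.1 ij.2) l.
  apply: abs_cvg_series; move: (h ij.1 ij.2); rewrite mxE.
  by apply: abs_cvg_eq => k; rewrite !mxE.
by exists (\matrix_(i, j) A (i, j)) => i j; rewrite mxE; apply: (hA (i, j)).
Qed.

End Matrices.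

(** * The absolute value on K and expansions in K_infty *)

Let T := iota (theta F).
Let t := abs T.

Lemma t_gt1 : 1 < t. Proof. exact: Cinfty_abs_theta hC. Qed.
Lemma t_gt0 : 0 < t. Proof. exact: lt_trans ltr01 t_gt1. Qed.

(** Bernoulli's inequality in the form n (t - 1) <= t^n. *)
Lemma t_archi (e : R) : 0 < e -> exists n, (t ^+ n)^-1 < e.
Proof.
move=> e0; have [n hn] : exists n, e^-1 < t ^+ n.
  have t1 : 0 < t - 1 by rewrite subr_gt0 t_gt1.
  have [n hn] : exists n : nat, e^-1 / (t - 1) < n%:R.
    by exists (Num.truncn (e^-1 / (t - 1))).+1; rewrite truncnS_gt.
  exists n; rewrite ltr_pdivrMr // in hn; apply: lt_le_trans hn _.
  elim: n => [|n IH]; first by rewrite mul0r exprn_ge0 // ltW ?t_gt0.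
  have -> : t ^+ n.+1 = t ^+ n + (t - 1) * t ^+ n by rewrite exprS; ring.
  by rewrite -natr1 mulrDl mul1r lerD // ler_peMr ?(ltW t1) // exprn_ege1 // ltW ?t_gt1.
by exists n; rewrite invf_plt ?posrE ?exprn_gt0 ?t_gt0.
Qed.

Lemma abs_const (c : F) : c != 0 -> abs (iota c%:P%:F) = 1.
Proof.
move=> c0; have q1 := finNzRing_gt1 F.
have : abs (iota c%:P%:F) ^+ #|F| = abs (iota c%:P%:F).
  by rewrite -absX -!rmorphXn /= expf_card.
rewrite -(ltn_predK q1) exprS -{3}[abs _]mulr1.
have a0 : 0 < abs (iota c%:P%:F).
  by apply: abs_gt0; rewrite fmorph_eq0 tofrac_eq0 polyC_eq0.
move/(mulfI (lt0r_neq0 a0)) => e.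
apply: (@pexpIrn _ #|F|.-1); rewrite ?nnegrE ?abs_ge0 //; first by rewrite -subn1 subn_gt0.
by rewrite e expr1n.
Qed.

Lemma abs_const_le1 (c : F) : abs (iota c%:P%:F) <= 1.
Proof.
case: (eqVneq c 0) => [->|/abs_const->//].
by rewrite polyC0 tofrac0 rmorph0 abs0.
Qed.

Lemma abs_poly (p : {poly F}) : p != 0 -> abs (iota p%:F) = t ^+ (size p).-1.
Proof.
elim/poly_ind: p => [|p c IH]; first by rewrite eqxx.
rewrite size_MXaddC tofracD tofracM rmorphD rmorphM /= -/T.
case: (eqVneq p 0) => [->|p0] /=.
  rewrite mul0r add0r size_poly0 tofrac0 rmorph0 mul0r add0r.
  case: (eqVneq c 0) => [->|c0]; first by rewrite polyC0 eqxx.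
  by move=> _; apply: abs_const.
move=> _; have e : t ^+ size p = abs (iota p%:F * T).
  by rewrite absM IH // -exprSr prednK // size_poly_gt0.
rewrite abs_addl -e // (le_lt_trans (abs_const_le1 c)) //.
by rewrite exprn_egt1 ?t_gt1 // -lt0n size_poly_gt0.
Qed.

Lemma abs_poly_lt (p : {poly F}) n : (size p <= n)%N -> abs (iota p%:F) < t ^+ n.
Proof.
move=> sp; case: (eqVneq p 0) => [->|p0].
  by rewrite tofrac0 rmorph0 abs0 exprn_gt0 ?t_gt0.
rewrite abs_poly // ltr_eXn2l ?t_gt1 // (leq_trans _ sp) // prednK //.
by rewrite size_poly_gt0.
Qed.

Lemma int_part (r : {fraction {poly F}}) : exists p : {poly F}, abs (iota (r - p%:F)) < 1.
Proof.
rewrite [r]frac_numdenE; set a := frac_num r; set b := frac_den r.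
have b0 : b != 0 by apply: frac_den_neq0.
have bF : b%:F != 0 :> {fraction {poly F}} by rewrite tofrac_eq0.
exists (a %/ b).
have -> : a%:F / b%:F - (a %/ b)%:F = (a %% b)%:F / b%:F.
  apply: (mulIf bF); rewrite mulrBl !divfK // {1}(divp_eq a b) tofracD tofracM.
  by rewrite addrAC subrr add0r.
rewrite fmorph_div /= absM absV (abs_poly b0) ltr_pdivrMr ?exprn_gt0 ?t_gt0 // mul1r.
by apply: abs_poly_lt; rewrite -ltnS prednK ?size_poly_gt0 // ltn_modp.
Qed.

(** The closure of K. It is shown to lie in the field of Laurent series in 1/theta, which places all
    limits of elements of K in K_infty. *)
Definition near_K x := forall e : R, 0 < e -> exists r, abs (x - iota r) < e.

(** The polynomial part p of an approximation of theta x satisfies |p| < |theta|, so p is a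
    constant. *)
Lemma near_K_digit x : near_K x -> abs x < 1 -> exists a : F, abs (T * x - iota a%:P%:F) < 1.
Proof.
move=> hx x1; have tV0 : 0 < t^-1 by rewrite invr_gt0 t_gt0.
have [r hr] := hx _ tV0; have [p hp] := int_part (theta F * r).
have Tp : abs (T * x - iota p%:F) < 1.
  have -> : T * x - iota p%:F = T * (x - iota r) + iota (theta F * r - p%:F).
    by rewrite rmorphB rmorphM /= mulrBr addrA subrK.
  by rewrite absD_lt // absM mulrC -ltr_pdivlMr ?t_gt0 // mul1r.
suff sp : (size p <= 1)%N by exists p`_0; rewrite -size1_polyC.
case: (eqVneq p 0) => [->|p0]; first by rewrite size_poly0.
have : abs (iota p%:F) < t.
  rewrite -[iota _](subKr (T * x)) absB_lt // ?(lt_trans Tp t_gt1) //.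
  by rewrite absM -[ltRHS]mulr1 ltr_pM2l ?t_gt0.
rewrite abs_poly // -[ltRHS]expr1 ltr_eXn2l ?t_gt1 //; lia.
Qed.

Lemma near_K_in_Kinfty x : near_K x -> in_Kinfty iota abs x.
Proof.
move=> hx; have t1 := t_gt1; have t0 := t_gt0.
have T0 : T != 0 by apply/eqP => T0; move: t0; rewrite /t T0 abs0 ltxx.
have [n hn] : exists n, abs x < t ^+ n.+1.
  have [n hn] := t_archi (e := (abs x + 1)^-1) ltac:(by rewrite invr_gt0 ltr_wpDl).
  exists n; rewrite exprS; move: hn.
  rewrite ltf_pV2 ?posrE ?exprn_gt0 // ?ltr_wpDl // => h.
  apply: (@lt_trans _ _ (t ^+ n)); first by apply: lt_trans h; rewrite ltrDl.
  by rewrite ltr_pMl ?exprn_gt0.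
have /choice[dg hdg] y : exists a : F, near_K y -> abs y < 1 -> abs (T * y - iota a%:P%:F) < 1.
  case: (pselect (near_K y /\ abs y < 1)) => [[h1 h2]|h].
    by have [a ha] := near_K_digit h1 h2; exists a.
  by exists 0 => h1 h2; case: h.
pose step y := T * y - iota (dg y)%:P%:F.
(* After scaling x into the open unit ball, iterating [step] strips one digit at a time; the digit 0
   is a default outside the domain of [near_K_digit]. *)
pose y i := iter i step (x / T ^+ n.+1).
have hy i : near_K (y i) /\ abs (y i) < 1.
  elim: i => [|i [IH1 IH2]] /=; last first.
    split; last exact: hdg.
    move=> e e0; have [r hr] := IH1 _ (divr_gt0 e0 t0).
    exists (theta F * r - (dg (y i))%:P%:F).
    rewrite rmorphB rmorphM /= /step opprB addrA subrK -mulrBr absM mulrC.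
    by rewrite -ltr_pdivlMr.
  rewrite /y /= absM absV absX ltr_pdivrMr ?exprn_gt0 // mul1r; split=> // e e0.
  have [r hr] := hx _ (mulr_gt0 e0 (exprn_gt0 n.+1 t0)).
  exists (r / theta F ^+ n.+1); rewrite fmorph_div rmorphXn /= -mulrBl absM absV absX.
  by rewrite ltr_pdivrMr ?exprn_gt0.
have xE m : x = \sum_(i < m) iota (dg (y i))%:P%:F * T ^ (n%:Z - i%:Z) + T ^+ n.+1 / T ^+ m * y m.
  elim: m => [|m IH].
    by rewrite big_ord0 add0r expr0 divr1 /y /= mulrC divfK // expf_neq0.
  rewrite {1}IH big_ord_recr /= -addrA; congr (_ + _).
  have -> : T ^ (n%:Z - m%:Z) = T ^+ n.+1 / T ^+ m.+1.
    by rewrite expfzDr // -exprnN exprnP !exprS invfM mulrACA divff // mul1r.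
  rewrite /= -/(y m) /step; set A := T ^+ n.+1 / T ^+ m.+1.
  have -> : T ^+ n.+1 / T ^+ m = A * T.
    by rewrite /A [T ^+ m.+1]exprSr invfM mulrA divfK.
  by move: (y m) A (iota _) => b a c; ring.
exists n, (dg \o y); apply/abs_cvgP => e e0.
have [k hk] := t_archi (divr_gt0 e0 (exprn_gt0 n.+1 t0)).
exists k => m le_km; rewrite absBC {1}(xE m) addrAC subrr add0r absM absM absV !absX.
apply: (@le_lt_trans _ _ (t ^+ n.+1 * (t ^+ k)^-1)).
  rewrite -[leRHS]mulr1 ler_pM ?mulr_ge0 ?invr_ge0 ?exprn_ge0 ?(ltW t0) ?abs_ge0 //.
    rewrite ler_wpM2l ?exprn_ge0 ?(ltW t0) // lef_pV2 ?posrE ?exprn_gt0 //.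
    by rewrite ler_eXn2l.
  exact: ltW (proj2 (hy m)).
by rewrite mulrC -ltr_pdivlMr ?exprn_gt0.
Qed.

Lemma cvg_in_Kinfty (u : nat -> {fraction {poly F}}) l :
  abs_cvg abs (fun n => iota (u n)) l -> in_Kinfty iota abs l.
Proof.
move=> /abs_cvgP h; apply: near_K_in_Kinfty => e /h[n hn].
by exists (u n); rewrite absBC hn.
Qed.

End Ultrametric.

(** * Bounds *)

Section Frobenius.
Variables (E : fieldType) (n : nat) (hn : (GRing.pchar E).-nat n).

(** The proof on the characteristic is an argument so that the ring morphism structure can be
    attached to the function. *)
Definition frob of (GRing.pchar E).-nat n := fun x : E => x ^+ n.

Lemma frob_is_zmod_morphism : zmod_morphism (frob hn).
Proof.
move=> x y; have n0 : (0 < n)%N by case/andP: hn.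
have e := exprDn_pchar (x - y) y hn.
by rewrite subrK in e; rewrite /frob e addrK.
Qed.

Lemma frob_is_monoid_morphism : monoid_morphism (frob hn).
Proof. by split=> [|x y]; rewrite /frob ?expr1n ?exprMn. Qed.

HB.instance Definition _ := GRing.isZmodMorphism.Build E E (frob hn) frob_is_zmod_morphism.
HB.instance Definition _ := GRing.isMonoidMorphism.Build E E (frob hn) frob_is_monoid_morphism.
End Frobenius.

Lemma pchar_nat_card (F : finFieldType) (E : fieldType) (f : {rmorphism F -> E}) :
  (GRing.pchar E).-nat #|F|.
Proof.
have [p pr_p pF] := finPcharP F.
have pE : p \in GRing.pchar E by rewrite (fmorph_pchar f).
rewrite (eq_pnat _ (pcharf_eq pE)) (card_pprimeChar pF).
by rewrite pnatX pnat_id.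
Qed.

(** * Transport along field morphisms *)

Section Morphisms.
Variables (E E' : fieldType) (f : {rmorphism E -> E'}) (d q : nat).

Lemma map_toep_mx z p : map_mx f (toep_mx d z p) = toep_mx d (f z) (map_poly f p).
Proof.
by apply/matrixP => i j; rewrite !mxE nderivn_map horner_map; case: ifP; rewrite ?rmorph0.
Qed.

Lemma map_node t j : f (node q t j) = node q (f t) j.
Proof. by rewrite /node rmorphXn. Qed.

Lemma map_node_poly t a b : map_poly f (node_poly d q t a b) = node_poly d q (f t) a b.
Proof.
rewrite /node_poly rmorph_prod; apply: eq_bigr => j _.
by rewrite rmorphXn /= rmorphB /= map_polyX map_polyC /= map_node.
Qed.

Lemma map_bmx t k : map_mx f (bmx d q t k) = bmx d q (f t) k.
Proof.
apply/matrixP => i j; rewrite !mxE -horner_map /= -nderivn_map; congr (_^`N(_).[_]).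
rewrite /bcol rmorph_sum; apply: eq_bigr => m _.
rewrite /= map_polyZ /= rmorphMn rmorphXn rmorphB /= !map_node; congr (_ *: _).
by rewrite rmorphXn /= rmorphB /= map_polyX map_polyC /= map_node.
Qed.

End Morphisms.

(** * Node polynomials normalized to constant term 1 *)

Section Normalized.
Variables (E : fieldType) (d q : nat) (t : E).
Hypothesis t0 : t != 0.
Local Notation nd := (node q t).

Definition lin_fact j : {poly E} := 1 - (nd j)^-1 *: 'X.
Definition nnode_poly a b : {poly E} := \prod_(a <= j < b) lin_fact j ^+ d.

Lemma node_neq0 j : nd j != 0. Proof. by rewrite expf_neq0. Qed.

Lemma XsubC_lin_fact j : 'X - (nd j)%:P = (- nd j) *: lin_fact j.
Proof.
rewrite /lin_fact scalerBr scalerA mulNr divff ?node_neq0 // scaleN1r opprK.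
by rewrite scaleNr -mul_polyC mulr1 addrC.
Qed.

Lemma node_polyE a b :
  node_poly d q t a b = (\prod_(a <= j < b) (- nd j) ^+ d) *: nnode_poly a b.
Proof.
rewrite /node_poly /nnode_poly; elim/big_rec3: _ => [|j x y z _ ->]; first by rewrite scale1r.
by rewrite XsubC_lin_fact exprZn -scalerAl -scalerAr scalerA.
Qed.

Lemma prod_node_neq0 a b : \prod_(a <= j < b) (- nd j) ^+ d != 0.
Proof.
by rewrite prodf_seq_neq0; apply/allP => j _; rewrite expf_neq0 // oppr_eq0 node_neq0.
Qed.

Lemma toep_lin_factE z j : toep_mx d z (lin_fact j)
  = 1%:M - (nd j)^-1 *: toep_mx d z 'X.
Proof.
by rewrite /lin_fact toep_mxD -scaleNr toep_mxZ -[1]/(1%:P) toep_mxC scaleNr.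
Qed.

End Normalized.

(** * Estimates for the matrices L_k *)

Section Bounds.
Variables (F : finFieldType) (R : realType) (C : fieldType).
Variables (iota : {rmorphism {fraction {poly F}} -> C}) (abs : C -> R).
Hypothesis hC : is_Cinfty iota abs.
Variable d : nat.

Local Notation q := #|F|.
Local Notation T := (iota (theta F)).
Local Notation t := (abs T).

Let t1 : 1 < t := t_gt1 hC.
Let t0 : 0 < t := t_gt0 hC.

Definition const_emb : F -> C := iota \o (@FracField.tofrac {poly F} \o polyC).
HB.instance Definition _ := GRing.RMorphism.on const_emb.

Lemma q_nat : (GRing.pchar C).-nat q.
Proof. exact: (pchar_nat_card const_emb). Qed.

Lemma qX_nat k : (GRing.pchar C).-nat (q ^ k)%N.
Proof. by rewrite pnatX q_nat. Qed.

Local Notation phi := (frob q_nat).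
Local Notation phik k := (frob (qX_nat k)).

Lemma T_neq0 : T != 0.
Proof. by apply/eqP => e; move: t0; rewrite e (abs0 hC) ltxx. Qed.

Local Notation nd := (node q T).

Lemma node_T_inj : injective nd.
Proof.
by move=> i j; rewrite -!map_node => /fmorph_inj; apply: theta_node_inj.
Qed.

Lemma abs_node j : abs (nd j) = t ^+ (q ^ j).
Proof. exact: (absX hC). Qed.

Let q1 : (1 < q)%N := finNzRing_gt1 F.

Lemma exp_le a b : (a <= b)%N -> t ^+ a <= t ^+ b.
Proof. by move=> h; rewrite ler_eXn2l. Qed.

Definition Lmx_C k : 'M[C]_d := map_mx iota (Lmx F d k).

Lemma Lmx_C_factor k : Lmx_C k *m toep_mx d (nd 1) (node_poly d q T 2 k.+2)
  = toep_mx d T (node_poly d q T 1 k.+1) *m bmx d q T k.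
Proof.
have := congr1 (map_mx iota) (Lmx_factor F d k).
by rewrite !map_mxM !map_toep_mx !map_node_poly map_bmx map_node.
Qed.

Lemma toep_le1 z j : abs z <= abs (nd j) -> mx_le abs (toep_mx d z (lin_fact q T j)) 1.
Proof.
move=> hz a b; have nj1 : 1 <= abs (nd j) by rewrite abs_node exprn_ege1 // ltW.
have nV : abs (nd j)^-1 <= 1 by rewrite (absV hC) invf_le1 // (lt_le_trans ltr01).
rewrite toep_lin_factE toep_mxX !mxE; apply: (absB_le hC) => //.
  by case: (a == b); rewrite ?mulr1n ?mulr0n ?(abs1 hC) ?(abs0 hC).
rewrite mulrDr (absD_le hC) //.
  case: (a == b); rewrite ?mulr1n ?mulr0n ?mulr0 ?(abs0 hC) //.
  rewrite (Cinfty_absM hC) (absV hC) mulrC ler_pdivrMr ?mul1r //.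
  exact: lt_le_trans ltr01 nj1.
by case: (_ == _); rewrite ?mulr1 ?mulr0 ?(abs0 hC).
Qed.

Lemma mx_le1M (M N : 'M[C]_d) : mx_le abs M 1 -> mx_le abs N 1 -> mx_le abs (M *m N) 1.
Proof. by move=> hM hN; rewrite -[1]mulr1; apply: (mx_leM hC). Qed.

Lemma mx_le_1 : mx_le abs (1%:M : 'M[C]_d) 1.
Proof.
by move=> i j; rewrite mxE; case: (i == j); rewrite ?mulr1n ?mulr0n ?(abs1 hC) ?(abs0 hC).
Qed.

Lemma toep_nnode_le1 z a b : (forall j, (a <= j)%N -> abs z <= abs (nd j)) ->
  mx_le abs (toep_mx d z (nnode_poly d q T a b)) 1.
Proof.
move=> hz; rewrite /nnode_poly big_seq.
elim/big_rec: _ => [|j x]; first by rewrite toep_mxC; apply: mx_le_1.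
rewrite mem_index_iota => /andP[le_aj _] IH; rewrite toep_mxM; apply: mx_le1M => //.
move: (X in _ ^+ X); elim=> [|n IHn]; first by rewrite expr0 toep_mxC; apply: mx_le_1.
by rewrite exprS toep_mxM; apply: mx_le1M => //; apply: toep_le1; apply: hz.
Qed.

Lemma abs_nnode_poly z a b : (forall j, (a <= j)%N -> abs z < abs (nd j)) ->
  abs (nnode_poly d q T a b).[z] = 1.
Proof.
move=> hz; rewrite /nnode_poly big_seq horner_prod (abs_prod1 hC) // => j.
rewrite mem_index_iota => /andP[le_aj _].
rewrite horner_exp (absX hC) /lin_fact hornerD hornerN hornerZ hornerX hornerC.
rewrite (abs_addl hC) ?(abs1 hC) ?expr1n // (absN hC) (Cinfty_absM hC) (absV hC) mulrC.
by rewrite ltr_pdivrMr ?mul1r ?hz // abs_node exprn_gt0.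
Qed.

Lemma nodes_gt a z : abs z = abs (nd a) -> forall j, (a.+1 <= j)%N -> abs z < abs (nd j).
Proof. by move=> -> j lt_aj; rewrite !abs_node ltr_eXn2l // ltn_exp2l. Qed.

Lemma inv_toep_nnode z a b : (forall j, (a <= j)%N -> abs z < abs (nd j)) ->
  toep_mx d z (nnode_poly d q T a b) \in unitmx
  /\ mx_le abs (invmx (toep_mx d z (nnode_poly d q T a b))) 1.
Proof.
move=> hz; apply: (invmx_le1 hC).
  by apply: toep_nnode_le1 => j le_aj; rewrite ltW // hz.
by rewrite det_toep_mx (absX hC) abs_nnode_poly // expr1n.
Qed.

(** Each entry is a sum of monomials of total degree at most d - 1 in z - y and x - y, both of
    absolute value at most |y|. *)
Lemma bmx_le k : mx_le abs (bmx d q T k) (t ^+ (q ^ k.+1 * (d - 1))).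
Proof.
have tl n : abs (nd n) <= t ^+ (q ^ n) by rewrite abs_node.
have sub_le a b : (a <= b)%N -> abs (nd a - nd b) <= t ^+ (q ^ b).
  move=> le_ab; apply: (absB_le hC) => //; rewrite abs_node exp_le // leq_exp2l //.
have T_node0 : T = nd 0 by rewrite /node expn0 expr1.
move=> i j; rewrite !mxE /bcol raddf_sum horner_sum /=.
apply: (abs_sum_le hC) => //; first by rewrite exprn_ge0 // ltW.
move=> m _; rewrite nderivnZ hornerZ nderivn_XsubCX hornerMn horner_exp hornerXsubC.
rewrite (Cinfty_absM hC).
apply: (@le_trans _ _ (t ^+ (q ^ k.+1 * (m - j)) * t ^+ (q ^ k.+1 * (d - m.+1 - (d - i.+1))))).
  rewrite ler_pM ?(Cinfty_abs_ge0 hC) //.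
    rewrite (le_trans (abs_mulrn hC _ _)) // (absX hC) exprM lerXn2r ?nnegrE ?(Cinfty_abs_ge0 hC) //.
      by rewrite exprn_ge0 // ltW.
    exact: sub_le.
  rewrite (le_trans (abs_mulrn hC _ _)) // (absX hC) exprM lerXn2r ?nnegrE ?(Cinfty_abs_ge0 hC) //.
    by rewrite exprn_ge0 // ltW.
  by rewrite {1}T_node0; apply: sub_le.
rewrite -exprD -mulnDr exp_le // leq_mul2l; apply/orP; right.
by have := ltn_ord m; have := ltn_ord i; lia.
Qed.

Lemma abs_prod_node a b : abs (\prod_(a <= j < b) (- nd j) ^+ d)
  = \prod_(a <= j < b) t ^+ (q ^ j * d).
Proof.
elim/big_rec2: _ => [|j x y _ <-]; first exact: (abs1 hC).
by rewrite (Cinfty_absM hC) (absX hC) (absN hC) abs_node exprM.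
Qed.

(** After normalization the Toeplitz factor on the left and the inverse of the one on the right are
    bounded by 1. The ratio of the constants telescopes to absolute value |theta|^(dq - d q^(k+1)),
    and [bmx] contributes |theta|^((d-1) q^(k+1)). *)
Lemma Lmx_C_le k : mx_le abs (Lmx_C k) (t ^+ (d * q) / t ^+ (q ^ k.+1)).
Proof.
have z1 : forall j, (2 <= j)%N -> abs (nd 1) < abs (nd j) by apply: nodes_gt.
have z0 : forall j, (1 <= j)%N -> abs T < abs (nd j).
  by apply: nodes_gt; rewrite /node expn0 expr1.
have [uV leV] := inv_toep_nnode k.+2 z1.
set c2 := \prod_(2 <= j < k.+2) (- nd j) ^+ d.
set c1 := \prod_(1 <= j < k.+1) (- nd j) ^+ d.
have c20 : c2 != 0 by apply: prod_node_neq0 T_neq0 _ _.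
have LE : Lmx_C k = (c1 / c2) *: (toep_mx d T (nnode_poly d q T 1 k.+1) *m bmx d q T k
     *m invmx (toep_mx d (nd 1) (nnode_poly d q T 2 k.+2))).
  have := Lmx_C_factor k; rewrite !(node_polyE d q T_neq0) -/c1 -/c2 !toep_mxZ.
  rewrite -scalemxAr -scalemxAl => e.
  rewrite mulrC -scalerA [X in _ *: X]scalemxAl -e -scalemxAl mulmxK //.
  by rewrite scalerA mulVf ?scale1r.
have absc : abs (c1 / c2) = t ^+ (q * d) / t ^+ (q ^ k.+1 * d).
  rewrite (Cinfty_absM hC) (absV hC) !abs_prod_node.
  have e : \prod_(1 <= j < k.+1) t ^+ (q ^ j * d) * t ^+ (q ^ k.+1 * d)
         = t ^+ (q * d) * \prod_(2 <= j < k.+2) t ^+ (q ^ j * d).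
    by rewrite -[LHS](big_nat_recr k.+1 1 (fun j => t ^+ (q ^ j * d))) // big_ltn // expn1.
  have tn0 n : t ^+ n != 0 by rewrite expf_neq0 // lt0r_neq0.
  have p0 : \prod_(2 <= j < k.+2) t ^+ (q ^ j * d) != 0.
    by rewrite prodf_seq_neq0; apply/allP => j _; rewrite tn0.
  by apply/eqP; rewrite eqr_div // e.
have b0 : 0 <= t ^+ (q ^ k.+1 * (d - 1)) by rewrite exprn_ge0 // ltW.
have le1 := toep_nnode_le1 k.+1 (fun j h => ltW (z0 j h)).
have := mx_leM hC (mx_leM hC le1 (@bmx_le k) ler01 b0) leV (mulr_ge0 ler01 b0) ler01.
rewrite mul1r mulr1 => h i j.
rewrite LE mxE (Cinfty_absM hC) absc.
apply: le_trans (ler_wpM2l _ (h i j)) _; first by rewrite divr_ge0 ?exprn_ge0 ?ltW.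
rewrite mulrAC ler_pdivrMr ?exprn_gt0 // mulrAC ler_pdivlMr ?exprn_gt0 // -!exprD exp_le //.
have := ltn_ord i; have := expn_gt0 q k.+1; rewrite (ltnW q1) /=.
move: (q ^ k.+1)%N => Q; nia.
Qed.

End Bounds.

(** * The limit of the partial products *)

Section Limits.
Variables (F : finFieldType) (R : realType) (C : fieldType).
Variables (iota : {rmorphism {fraction {poly F}} -> C}) (abs : C -> R).
Hypothesis hC : is_Cinfty iota abs.
Variable d : nat.

Local Notation q := #|F|.
Local Notation T := (iota (theta F)).
Local Notation t := (abs T).
Local Notation nd := (node q T).
Local Notation phi := (frob (q_nat iota)).
Local Notation phik k := (frob (qX_nat iota k)).
Local Notation L := (Lmx_C iota d).
Local Notation P := (twisted_prod phi L).
Local Notation e_d1 := (e_d1mx C d).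

Let t1 : 1 < t := t_gt1 hC.
Let t0 : 0 < t := t_gt0 hC.
Let q1 : (1 < q)%N := finNzRing_gt1 F.
Let T0 : T != 0 := T_neq0 hC.
Let abs_ge0 := Cinfty_abs_ge0 hC.
Let absM := Cinfty_absM hC.
Let cvg_eq u v l : u =1 v -> abs_cvg abs u l -> abs_cvg abs v l.
Proof. exact: (abs_cvg_eq hC). Qed.
Let mcvg_eq m n (M N : nat -> 'M[C]_(m, n)) A :
  M =1 N -> mx_cvg abs M A -> mx_cvg abs N A.
Proof. exact: (mx_cvg_eq hC). Qed.

Lemma mx_twist_phi k m n (M : 'M[C]_(m, n)) : mx_twist q k M = map_mx (phik k) M.
Proof. by []. Qed.

Lemma mx_twist_phi1 m n (M : 'M[C]_(m, n)) : mx_twist q 1 M = map_mx phi M.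
Proof. by apply/matrixP => i j; rewrite !mxE expn1. Qed.

Lemma mx_twistM k m n p (M : 'M[C]_(m, n)) (N : 'M[C]_(n, p)) :
  mx_twist q k (M *m N) = mx_twist q k M *m mx_twist q k N.
Proof. by rewrite !mx_twist_phi map_mxM. Qed.

Lemma mx_twistS k m n (M : 'M[C]_(m, n)) :
  mx_twist q k.+1 M = map_mx phi (mx_twist q k M).
Proof. by apply/matrixP => i j; rewrite !mxE /= /frob -exprM -expnSr. Qed.

Lemma series_partial_prod k j : series_map iota (partial_prod F d k) j = P k j.
Proof.
elim: k j => [|k IH] j /=.
  by rewrite /series_map /tmono; case: eqP => _; rewrite ?map_mx1 ?map_mx0.
rewrite -IH /series_map /tmul big_ord_recl /= /tmono /= subr0 subn0 mul1mx map_mxD.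
have tw0 (M : 'M[{fraction {poly F}}]_d) : mx_twist q 0 M = M.
  by apply/matrixP => a b; rewrite !mxE expn0 expr1.
rewrite tw0; congr (_ + _); case: j => [|j]; first by rewrite big_ord0 map_mx0 oppr0.
rewrite big_ord_recl big1 ?addr0 => [|i _]; last by rewrite /= subr0 mul0mx.
rewrite /= sub0r mulNmx map_mxN map_mxM subn1 -mx_twist_phi1 -IH; congr (- (_ *m _)).
by apply/matrixP => a b; rewrite !mxE rmorphXn.
Qed.

(* The exponent (2d - j) q^j - 2d is stable under the recursion
   P_(k+1,j+1) = P_(k,j+1) - L_k P_(k,j)^(1), as |L_k| <= |theta|^(dq - q^(k+1)). *)
Definition coef_bound j : R := t ^+ (2 * d * q ^ j) / t ^+ (j * q ^ j + 2 * d).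

Lemma coef_bound_ge0 j : 0 <= coef_bound j.
Proof. by rewrite divr_ge0 // exprn_ge0 // ltW. Qed.

Lemma mx_le_phi m n (M : 'M[C]_(m, n)) B : mx_le abs M B -> mx_le abs (map_mx phi M) (B ^+ q).
Proof.
move=> h i j; rewrite mxE /= /frob (absX hC) lerXn2r ?nnegrE //.
by rewrite (le_trans (abs_ge0 (M i j))).
Qed.

Lemma prod_le k j : mx_le abs (P k j) (coef_bound j).
Proof.
elim: k j => [|k IH] [|j] a b /=.
- rewrite /coef_bound mul0n add0n expn0 muln1 divff ?expf_neq0 ?lt0r_neq0 //.
  exact: (mx_le_1 hC).
- by rewrite mxE (abs0 hC) coef_bound_ge0.
- by rewrite subr0; apply: IH.
apply: (mx_leB hC); first exact: IH.
(* The exponents are compared using q^(j+1) <= q^(k+1), which needs j <= k; beyond that the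
   coefficient of P_k is zero. *)
case: (leqP j k) => [le_jk|lt_kj]; last first.
  by move=> a' b'; rewrite twisted_prod_gt // map_mx0 mulmx0 mxE (abs0 hC) coef_bound_ge0.
have LB0 : 0 <= t ^+ (d * q) / t ^+ (q ^ k.+1) by rewrite divr_ge0 // exprn_ge0 // ltW.
move=> a' b'; apply: le_trans (mx_leM hC (@Lmx_C_le _ _ _ _ _ hC d k) (mx_le_phi (IH j)) LB0 _ a' b') _.
  by rewrite exprn_ge0 // coef_bound_ge0.
rewrite /coef_bound expr_div_n -!exprM mulf_div -!exprD.
rewrite ler_pdivrMr ?exprn_gt0 // mulrAC ler_pdivlMr ?exprn_gt0 // -!exprD (exp_le hC) //.
have : (q ^ j.+1 <= q ^ k.+1)%N by rewrite leq_exp2l.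
rewrite !mulnDl -!mulnA -!expnSr.
move: (q ^ j.+1)%N (q ^ k.+1)%N => Q Q'; have := q1; move: (#|_|) => q'.
nia.
Qed.

Lemma cvg0_node (u : nat -> C) B : (forall n, abs (u n) <= B / t ^+ (q ^ n)) -> abs_cvg abs u 0.
Proof.
move=> h; apply/(abs_cvgP hC) => e e0.
have B0 : 0 <= B.
  have := le_trans (abs_ge0 _) (h 0%N).
  by rewrite pmulr_lge0 // invr_gt0 exprn_gt0.
have B1 : 0 < B + 1 by rewrite ltr_wpDl.
have [n hn] := t_archi hC (divr_gt0 e0 B1).
exists n => k le_nk; rewrite subr0 (le_lt_trans (h k)) //.
apply: (@le_lt_trans _ _ ((B + 1) * (t ^+ n)^-1)); last by rewrite mulrC -ltr_pdivlMr.
rewrite ler_pM ?invr_ge0 ?exprn_ge0 ?(ltW t0) ?lerDl //.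
rewrite lef_pV2 ?posrE ?exprn_gt0 // (exp_le hC) //.
by apply: leq_trans le_nk _; rewrite ltnW // ltn_expl.
Qed.

(** Consecutive terms differ by L_k times a twisted coefficient that is bounded uniformly in k, and
    L_k tends to 0. *)
Lemma prod_cvg j : exists A : 'M[C]_d, mx_cvg abs (P ^~ j) A.
Proof.
apply: (mx_cvg_series hC) => a b; rewrite mxE.
case: j => [|j].
  apply: cvg_eq (abs_cvg_cst hC 0) => k.
  by rewrite /= subr0 subrr mxE.
apply: (@cvg0_node _ (t ^+ (d * q) * coef_bound j ^+ q)) => k.
rewrite /= addrAC subrr add0r mxE (absN hC).
have LB0 : 0 <= t ^+ (d * q) / t ^+ (q ^ k.+1) by rewrite divr_ge0 // exprn_ge0 // ltW.
apply: le_trans (mx_leM hC (@Lmx_C_le _ _ _ _ _ hC d k) (mx_le_phi (@prod_le k j)) LB0 _ a b) _.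
  by rewrite exprn_ge0 // coef_bound_ge0.
rewrite mulrAC ler_wpM2l ?mulr_ge0 ?exprn_ge0 ?coef_bound_ge0 ?(ltW t0) //.
by rewrite lef_pV2 ?posrE ?exprn_gt0 // (exp_le hC) // leq_exp2l.
Qed.

Definition lim_prod := projT1 (choice prod_cvg).

Lemma lim_prod_cvg j : mx_cvg abs (P ^~ j) (lim_prod j). Proof. exact: projT2 (choice prod_cvg) j. Qed.

Lemma lim_prod_le j : mx_le abs (lim_prod j) (coef_bound j).
Proof. by move=> a b; apply: (abs_cvg_le hC _ (@lim_prod_cvg j a b)) => k; apply: prod_le. Qed.

Lemma lim_prod_Kinfty j r s : in_Kinfty iota abs (lim_prod j r s).
Proof.
apply: (cvg_in_Kinfty hC (u := fun k => partial_prod F d k j r s)).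
by apply: cvg_eq (@lim_prod_cvg j r s) => k; rewrite -series_partial_prod mxE.
Qed.

Lemma lim_prod0 : lim_prod 0 = 1%:M.
Proof.
apply: (mx_cvg_uniq hC (@lim_prod_cvg 0)).
by apply: mcvg_eq (mx_cvg_cst hC 1%:M) => k; rewrite twisted_prod0.
Qed.

Lemma vec_bound n (Y : 'cV[C]_n) : exists m, mx_le abs Y (t ^+ m).
Proof.
have [B hB] : exists B : R, mx_le abs Y B.
  exists (\sum_i abs (Y i 0)) => i j; rewrite ord1 (bigD1 i) //= lerDl.
  by rewrite sumr_ge0.
have [m hm] := t_archi hC (e := (`|B| + 1)^-1) ltac:(by rewrite invr_gt0 ltr_wpDl).
exists m => i j; apply: (le_trans (hB i j)); apply: (le_trans (ler_norm _)).
rewrite ltf_pV2 ?posrE ?exprn_gt0 // ?ltr_wpDl // in hm.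
by apply: ltW; apply: lt_trans hm; rewrite ltrDl.
Qed.

(** If |Y| <= |theta|^m, the exponent is at most (2d + m - j) q^j - 2d, which tends to minus
    infinity. The bound is uniform in M, so it serves for P_k and for the limit together. *)
Lemma tail_bound (Y : 'cV[C]_d) (e : R) : 0 < e -> exists J, forall j, (J <= j)%N ->
  forall M : 'M[C]_d, mx_le abs M (coef_bound j) -> forall i, abs ((M *m mx_twist q j Y) i 0) < e.
Proof.
move=> /(t_archi hC)[n hn]; have [m hm] := vec_bound Y.
exists (2 * d + m + n)%N => j le_j M hM i; apply: le_lt_trans hn.
have hY : mx_le abs (mx_twist q j Y) (t ^+ (m * q ^ j)).
  by move=> a b; rewrite mxE (absX hC) exprM lerXn2r ?nnegrE // exprn_ge0 // ltW.
apply: le_trans (mx_leM hC hM hY (coef_bound_ge0 j) _ i 0) _; first by rewrite exprn_ge0 // ltW.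
rewrite /coef_bound -[leRHS]mul1r mulrAC ler_pdivrMr ?exprn_gt0 // mulrAC ler_pdivlMr ?exprn_gt0 //.
rewrite mul1r -!exprD (exp_le hC) //.
have Q0 : (0 < q ^ j)%N by rewrite expn_gt0 (ltnW q1).
rewrite -mulnDl (leq_trans _ (leq_addr _ _)) // (leq_trans _ (leq_mul le_j (leqnn _))) //.
by rewrite [leqRHS]mulnDl leq_add2l leq_pmulr.
Qed.

(** * Action on vectors and the limit of the functional equation *)

Definition prod_act k (Y : 'cV[C]_d) := \sum_(j < k.+1) P k j *m mx_twist q j Y.

(** Dominated convergence: finitely many terms converge and the tails are uniformly small. *)
Lemma prod_act_cvg (Y : 'cV[C]_d) :
  mx_cvg abs (fun k => prod_act k Y - \sum_(j < k.+1) lim_prod j *m mx_twist q j Y) 0.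
Proof.
move=> i c; rewrite mxE ord1; apply/(abs_cvgP hC) => e e0.
have [J hJ] := tail_bound Y e0.
have h (j : 'I_J) := mx_cvgM hC (mx_cvgB hC (@lim_prod_cvg j) (mx_cvg_cst hC (lim_prod j)))
  (mx_cvg_cst hC (mx_twist q j Y)) i 0.
have := abs_cvg_sum hC (index_enum 'I_J) (P := xpredT) (fun j _ => h j).
rewrite (eq_bigr (fun=> 0)) => [|j _]; last by rewrite subrr mul0mx mxE.
rewrite big1 // => /(abs_cvgP hC)/(_ e e0)[n0 hn0].
exists (maxn J n0) => k; rewrite geq_max subr0 => /andP[le_Jk /hn0].
rewrite subr0 => hk; rewrite /prod_act -sumrB summxE.
rewrite (eq_bigr (fun j : 'I_k.+1 => ((P k j - lim_prod j) *m mx_twist q j Y) i 0)); last first.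
  by move=> j _; rewrite mulmxBl.
rewrite -(big_mkord xpredT (fun j => ((P k j - lim_prod j) *m mx_twist q j Y) i 0)).
rewrite (big_cat_nat (leq0n J)) ?leqW //=; apply: (absD_lt hC); first by rewrite big_mkord.
rewrite big_nat; apply: (@abs_sum_lt _ _ _ _ _ hC _ _ _ _ _ e0) => j /andP[le_Jj _]; apply: hJ => //.
by apply: (mx_leB hC); [apply: prod_le | apply: lim_prod_le].
Qed.

Lemma prod_act_series (Y W : 'cV[C]_d) :
  mx_cvg abs (prod_act ^~ Y) W <-> series_act F abs lim_prod Y W.
Proof.
rewrite /series_act; split=> h.
  apply/(mx_cvg_shift hC _ _ 1); have := mx_cvgB hC h (prod_act_cvg Y); rewrite subr0.
  by apply: mcvg_eq => k; rewrite subKr addn1.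
have {}h := proj1 (mx_cvg_shift hC _ _ 1) h; have := mx_cvgD hC (prod_act_cvg Y) h; rewrite add0r.
by apply: mcvg_eq => k; rewrite addn1 subrK.
Qed.

Let nd_inj : injective nd := @node_T_inj F C iota.
Let nd0 : nd 0 = T. Proof. by rewrite /node expn0 expr1. Qed.
Let phiE (x : C) : phi x = x ^+ q. Proof. by []. Qed.

Lemma prod_kills k : kills k.+1 (P k) nd (d * k).
Proof. exact: (twisted_prod_kills phiE (Lmx_C_factor iota d)). Qed.

Definition conn_lim := lim_prod 1 *m toep_mx d (nd 1) 'X - toep_mx d T 'X *m lim_prod 1.

Lemma map_phi_cvg m n (M : nat -> 'M[C]_(m, n)) A : mx_cvg abs M A ->
  mx_cvg abs (fun k => map_mx phi (M k)) (map_mx phi A).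
Proof.
move=> h i j; rewrite mxE; apply: cvg_eq (abs_cvgX hC q (h i j)) => k.
by rewrite mxE.
Qed.

Lemma conn_cvg : mx_cvg abs (conn_mx q phi T L) conn_lim.
Proof.
apply: (mx_cvgB hC); apply: (mx_cvgM hC); try exact: (mx_cvg_cst hC); exact: lim_prod_cvg.
Qed.

Lemma lim_prod_X j : lim_prod j *m toep_mx d (nd j) 'X = toep_mx d T 'X *m lim_prod j
   + (if j is i.+1 then conn_lim *m map_mx phi (lim_prod i) else 0).
Proof.
apply: (mx_cvg_uniq hC (M := fun k => P k.+1 j *m toep_mx d (nd j) 'X)).
  apply: (mx_cvgM hC) (mx_cvg_cst hC _).
  have := proj1 (mx_cvg_shift hC _ _ 1) (@lim_prod_cvg j).
  by apply: mcvg_eq => k; rewrite addn1.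
have e k := esym (twisted_prod_X phiE nd_inj (Lmx_C_factor iota d) k j).
apply: mcvg_eq e _; apply: (mx_cvgD hC).
  apply: (mx_cvgM hC) (mx_cvg_cst hC _) _.
  have := proj1 (mx_cvg_shift hC _ _ 1) (@lim_prod_cvg j).
  by apply: mcvg_eq => k; rewrite addn1.
case: j => [|j]; first exact: (mx_cvg_cst hC).
apply: (mx_cvgM hC); last exact/map_phi_cvg/lim_prod_cvg.
have := proj1 (mx_cvg_shift hC _ _ 1) conn_cvg.
by apply: mcvg_eq => k; rewrite addn1.
Qed.

(* W_k(theta + N), for W_k = \prod_(1 <= j <= k) (1 - x / theta^(q^j))^d *)
Definition Omega k := toep_mx d T (nnode_poly d q T 1 k.+1).

Let gt1 : forall j, (1 <= j)%N -> abs T < abs (nd j).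
Proof. by apply: (nodes_gt hC); rewrite nd0. Qed.

Lemma Omega_le k : mx_le abs (Omega k) 1.
Proof. by apply: (toep_nnode_le1 hC) => j /gt1/ltW. Qed.

Lemma lin_fact_cvg : mx_cvg abs (fun k => toep_mx d T (lin_fact q T k)) 1%:M.
Proof.
have h0 : abs_cvg abs (fun k => (nd k)^-1) 0.
  apply: (@cvg0_node _ 1) => k; by rewrite (absV hC) (abs_node hC) mul1r.
move=> i j; have := abs_cvgD hC (abs_cvg_cst hC (1%:M i j))
  (abs_cvgM hC (abs_cvgN hC h0) (abs_cvg_cst hC (toep_mx d T 'X i j))).
rewrite oppr0 mul0r addr0; apply: cvg_eq => k.
by rewrite toep_lin_factE !mxE mulNr.
Qed.

(** The increment is [Omega k], bounded by 1, times a matrix E_k - 1 that tends to 0. *)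
Lemma Omega_cvg_ex : exists A, mx_cvg abs Omega A.
Proof.
apply: (mx_cvg_series hC).
pose E k := toep_mx d T (lin_fact q T k.+1 ^+ d).
have hE n : mx_cvg abs (fun k => toep_mx d T (lin_fact q T k.+1 ^+ n)) 1%:M.
  elim: n => [|n IH].
    by apply: mcvg_eq (mx_cvg_cst hC 1%:M) => k; rewrite expr0 toep_mxC.
  have := mx_cvgM hC (proj1 (mx_cvg_shift hC _ _ 1) lin_fact_cvg) IH.
  by rewrite mul1mx; apply: mcvg_eq => k; rewrite exprS toep_mxM addn1.
have OE k : Omega k.+1 - Omega k = Omega k *m (E k - 1%:M).
  rewrite mulmxBr mulmx1 -toep_mxM; congr (toep_mx _ _ _ - _).
  by rewrite /nnode_poly big_nat_recr.
move=> i j; apply: (@cvg_eq (fun k => \sum_l (E k - 1%:M) l j * Omega k i l)).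
  by move=> k; rewrite OE mxE; apply: eq_bigr => l _; rewrite mulrC.
have -> : (0 : 'M[C]_d) i j = \sum_(l < d) 0 by rewrite big1 ?mxE.
apply: (abs_cvg_sum hC) => l _; apply: (abs_cvg0_bounded hC (B := 1)); last by move=> k; apply: Omega_le.
have := mx_cvgB hC (hE d) (mx_cvg_cst hC 1%:M) l j; rewrite subrr mxE.
exact: cvg_eq.
Qed.

Definition Omega_lim := projT1 (cid Omega_cvg_ex).
Lemma Omega_cvg : mx_cvg abs Omega Omega_lim. Proof. exact: projT2 (cid Omega_cvg_ex). Qed.

(** The limit is upper triangular, and its diagonal entries are limits of W_k(theta), all of
    absolute value 1. *)
Lemma Omega_lim_unit : Omega_lim \in unitmx.
Proof.
suff dV : abs (\det Omega_lim) = 1.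
  by rewrite unitmxE unitfE; apply/eqP => e; move: dV; rewrite e (abs0 hC) => /eqP; rewrite eq_sym oner_eq0.
have V_low (i j : 'I_d) : (j < i)%N -> Omega_lim i j = 0.
  move=> lt_ji; apply: (abs_cvg_uniq hC (@Omega_cvg i j)).
  by apply: cvg_eq (abs_cvg_cst hC 0) => k; rewrite mxE leqNgt lt_ji.
rewrite -det_tr det_trig; last by apply/is_trig_mxP => i j lt_ij; rewrite mxE V_low.
apply: (abs_prod1 hC) => i _; rewrite mxE.
apply: (abs_cvg_norm hC ltr01 _ (@Omega_cvg i i)) => k.
by rewrite mxE leqnn subnn nderivn0; apply: (abs_nnode_poly hC).
Qed.

Lemma Omega_lim_comm f : Omega_lim *m toep_mx d T f = toep_mx d T f *m Omega_lim.
Proof.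
apply: (mx_cvg_uniq hC (mx_cvgM hC Omega_cvg (mx_cvg_cst hC (toep_mx d T f)))).
apply: mcvg_eq (mx_cvgM hC (mx_cvg_cst hC _) Omega_cvg) => k.
exact: toep_mxCM.
Qed.

Lemma map_phi_Omega k : map_mx phi (Omega k) = toep_mx d (nd 1) (nnode_poly d q T 2 k.+2).
Proof.
rewrite /Omega map_toep_mx -nd0 phi_node //; congr toep_mx.
rewrite /nnode_poly rmorph_prod [RHS]big_add1 /=; apply: eq_bigr => j _.
rewrite rmorphXn /= /lin_fact rmorphB rmorph1 /= map_polyZ map_polyX /=.
by rewrite fmorphV phi_node.
Qed.

(** The limit of [conn_mxE]: normalizing both node polynomials cancels all constants except the one
    of the node theta^q. *)
Lemma conn_lim_Omega : (0 < d)%N -> conn_lim *m map_mx phi Omega_lim = (- nd 1) ^+ d *: (Omega_lim *m e_d1).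
Proof.
move=> d0.
apply: (mx_cvg_uniq hC (M := fun k => conn_mx q phi T L (k + 1)%N *m map_mx phi (Omega k))).
  apply: (mx_cvgM hC); last exact: map_phi_cvg Omega_cvg.
  exact: (proj1 (mx_cvg_shift hC _ _ 1) conn_cvg).
have h : mx_cvg abs (fun k => (- nd 1) ^+ d *: (Omega (k + 1)%N *m e_d1)) ((- nd 1) ^+ d *: (Omega_lim *m e_d1)).
  have h1 := mx_cvgM hC (proj1 (mx_cvg_shift hC _ _ 1) Omega_cvg) (mx_cvg_cst hC e_d1).
  move=> i j; rewrite mxE; apply: cvg_eq (abs_cvgM hC (abs_cvg_cst hC ((- nd 1) ^+ d)) (h1 i j)) => k.
  by rewrite [RHS]mxE.
apply: mcvg_eq h => k; rewrite addn1 map_phi_Omega.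
have := conn_mxE phiE (Lmx_C_factor iota d) k d0.
rewrite !(node_polyE d q T0) !toep_mxZ [in RHS]big_ltn // -scalemxAr -scalemxAl mulrC -scalerA.
by move/(scalerI (prod_node_neq0 d q T0 2 k.+2)) => ->.
Qed.

End Limits.

(** * Comparison with the exponential *)

Section Intertwiners.
Variables (E : fieldType) (d : nat).

(** D also intertwines (X - a)^d, which is zero at a + N and invertible at b + N. *)
Lemma intertwiner0 (D : 'M[E]_d) (a b : E) : a != b ->
  D *m toep_mx d b 'X = toep_mx d a 'X *m D -> D = 0.
Proof.
move=> ne_ab h.
have h1 : D *m toep_mx d b ('X - a%:P) = toep_mx d a ('X - a%:P) *m D.
  by rewrite -polyCN !toep_mxD !toep_mxC mulmxDr mulmxDl h mul_mx_scalar mul_scalar_mx.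
have hn n : D *m toep_mx d b (('X - a%:P) ^+ n) = toep_mx d a (('X - a%:P) ^+ n) *m D.
  elim: n => [|n IH]; first by rewrite !expr0 !toep_mxC mul_mx_scalar mul_scalar_mx.
  by rewrite !exprS !toep_mxM mulmxA h1 -mulmxA IH mulmxA.
have ub : toep_mx d b (('X - a%:P) ^+ d) \in unitmx.
  by apply: toep_mx_unit; rewrite horner_exp hornerXsubC expf_neq0 // subr_eq0 eq_sym.
by rewrite -[D](mulmxK ub) hn toep_mx_XsubCX ?mul0mx.
Qed.

Lemma toep_commX (M : 'M[E]_d) a f : M *m toep_mx d a 'X = toep_mx d a 'X *m M ->
  M *m toep_mx d a f = toep_mx d a f *m M.
Proof.
move=> h; elim/poly_ind: f => [|f c IH].
  by rewrite -(scale0r 0) toep_mxZ !scale0r mulmx0 mul0mx.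
by rewrite toep_mxD toep_mxM toep_mxC mulmxDr mulmxDl mulmxA IH -!mulmxA h
           mul_mx_scalar mul_scalar_mx.
Qed.

(** The jet of 1 is the last basis vector; a matrix commuting with N is recovered from its last
    column by applying powers of N. *)
Lemma period_mx_comm (M : 'M[E]_d) a : M *m toep_mx d a 'X = toep_mx d a 'X *m M ->
  period_mx (M *m jet d a 1) = M.
Proof.
move=> hM; apply/matrixP => i j.
have e : M *m delta_mx j (0 : 'I_1) = toep_mx d a (('X - a%:P) ^+ (d - j.+1)) *m (M *m jet d a 1).
  by rewrite mulmxA -toep_commX // -mulmxA -jetM mulr1 jet_XsubCX.
have := congr1 (fun v : 'cV[E]_d => v i 0) e; rewrite -colE [X in X = _ -> _]mxE => ->.
set v := M *m _; rewrite !mxE /period_coord.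
under [RHS]eq_bigr => k _ do rewrite mxE nderivn_XsubCX_root.
case: (leqP i j) => [le_ij|lt_ji]; last first.
  rewrite big1 // => k _; case: ifP => [le_ik|]; last by rewrite mul0r.
  by rewrite (_ : (_ == _) = false) ?mul0r //; apply/eqP; have := ltn_ord k; lia.
rewrite (bigD1 (rev_ord (ord_sub j i))) //= big1 ?addr0 => [|k].
  rewrite ifT; last by have := ltn_ord j; lia.
  by rewrite (_ : (_ == _) = true) ?mul1r //; apply/eqP; have := ltn_ord j; lia.
rewrite -val_eqE /= => ne; case: ifP => [le_ik|]; last by rewrite mul0r.
rewrite (_ : (_ == _) = false) ?mul0r //; apply/eqP => e'; case/eqP: ne.
by have := ltn_ord k; have := ltn_ord j; lia.
Qed.

Lemma period_mxZ c (v : 'cV[E]_d) : period_mx (c *: v) = c *: period_mx v.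
Proof. by apply/matrixP => i j; rewrite !mxE /period_coord; case: ifP; rewrite ?mxE ?mulr0. Qed.

End Intertwiners.

Lemma mx_twist0 (A : comNzRingType) q m n (M : 'M[A]_(m, n)) : mx_twist q 0 M = M.
Proof. by apply/matrixP => i j; rewrite mxE expn0 expr1. Qed.

Lemma tmul_tmono0r (A : comNzRingType) q d (f : nat -> 'M[A]_d) M j : (0 < q)%N ->
  tmul q f (tmono 0 M) j = f j *m mx_twist q j M.
Proof.
move=> q0; rewrite /tmul big_ord_recr /= subnn big1 ?add0r // => i _.
rewrite /tmono ifF; last by apply/eqP; have := ltn_ord i; lia.
apply/matrixP => a b; rewrite !mxE big1 // => c _.
by rewrite !mxE expr0n expn_eq0 eqn0Ngt q0 mulr0.
Qed.

Lemma tmul_tmono0l (A : comNzRingType) q d (f : nat -> 'M[A]_d) M j :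
  tmul q (tmono 0 M) f j = M *m f j.
Proof.
rewrite /tmul big_ord_recl /= subn0 mx_twist0 big1 ?addr0 // => i _.
by rewrite /tmono /= mul0mx.
Qed.

Lemma poly_at_thetaN_toep (F : finFieldType) d (a : {poly F}) :
  poly_at_thetaN d a = toep_mx d (theta F) (map_poly (@FracField.tofrac {poly F} \o polyC) a).
Proof.
have eX n : (toep_mx d (theta F) 'X) ^+ n = toep_mx d (theta F) 'X^n.
  elim: n => [|n IH]; first by rewrite !expr0 toep_mxC.
  by rewrite !exprS toep_mxM -IH.
rewrite /poly_at_thetaN /map_poly poly_def.
have -> : (theta F)%:M + Nmx F d = toep_mx d (theta F) 'X by rewrite toep_mxX.
rewrite (big_morph _ (@toep_mxD _ _ _) (_ : toep_mx d (theta F) 0 = 0)).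
  by apply: eq_bigr => i _; rewrite toep_mxZ eX.
by rewrite toep_mxC; apply/matrixP => i j; rewrite !mxE mul0rn.
Qed.

(** * The candidate period matrix and the conjugated limit *)

Section Main.
Variables (F : finFieldType) (R : realType) (C : fieldType).
Variables (iota : {rmorphism {fraction {poly F}} -> C}) (abs : C -> R).
Hypothesis hC : is_Cinfty iota abs.
Variable d : nat.
Hypothesis d0 : (0 < d)%N.

Local Notation q := #|F|.
Local Notation T := (iota (theta F)).
Local Notation t := (abs T).
Local Notation nd := (node q T).
Local Notation phi := (frob (q_nat iota)).
Local Notation P := (twisted_prod phi (Lmx_C iota d)).
Local Notation e_d1 := (e_d1mx C d).
Local Notation S := (lim_prod hC d).
Local Notation V := (Omega_lim hC d).
Local Notation emb := (const_emb iota).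

Let q1 : (1 < q)%N := finNzRing_gt1 F.
Let T0 : T != 0 := T_neq0 hC.
Let nd0 : nd 0 = T. Proof. by rewrite /node expn0 expr1. Qed.

Lemma kappa_ex : exists2 k : C, k != 0 & k ^+ q = k * (- nd 1) ^+ d.
Proof.
(* For a root c of X^(q-1) + theta, take kappa = c^(qd); then kappa^(q-1) = (-theta)^(qd) =
   (-theta^q)^d, as Frobenius preserves signs. *)
pose r := 'X^(q.-1) - (- theta F)%:P.
have q0 : (0 < q.-1)%N by rewrite -subn1 subn_gt0.
have K_alg c : algebraic_over_Kinfty iota abs (iota c).
  have inK b : in_Kinfty iota abs (iota b).
    by apply: (near_K_in_Kinfty hC) => e e0; exists b; rewrite subrr (abs0 hC).
  exists (map_poly iota ('X - c%:P)); split=> [|i|].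
  - by rewrite map_poly_eq0 polyXsubC_eq0.
  - by rewrite coef_map; apply: inK.
  - by rewrite rootE horner_map hornerXsubC subrr rmorph0.
have [] := Cinfty_closure hC (p := map_poly iota r).
- by rewrite size_map_poly size_XnsubC.
- by move=> i; rewrite coef_map; apply: K_alg.
move=> c _; rewrite rootE rmorphB /= map_polyXn map_polyC /= hornerD hornerN hornerXn hornerC.
rewrite subr_eq0 => /eqP hc.
have c0 : c != 0.
  by apply/eqP => c0; move/eqP: hc; rewrite c0 expr0n eqn0Ngt q0 /= rmorphN eq_sym oppr_eq0 (negPf T0).
exists (c ^+ (q * d)); first by rewrite expf_neq0.
have -> : - nd 1 = (c ^+ q.-1) ^+ q.
  by rewrite hc -[RHS]/(phi _) rmorphN rmorphN /= /frob /node expn1.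
rewrite -!exprM -exprD; congr (_ ^+ _).
by move: q0 q1; move: (#|_|) => Q; nia.
Qed.

Definition kappa := s2val (cid2 kappa_ex).
Lemma kappa_neq0 : kappa != 0. Proof. exact: s2valP (cid2 kappa_ex). Qed.
Lemma kappaE : kappa ^+ q = kappa * (- nd 1) ^+ d. Proof. exact: s2valP' (cid2 kappa_ex). Qed.

(** Up to a factor in F_q^x this is the Toeplitz matrix of the given period, by [hatPi_period]. *)
Definition hatPi := kappa *: invmx V.
Definition hatPi_inv := kappa^-1 *: V.

Lemma hatPiK : hatPi *m hatPi_inv = 1%:M.
Proof. by rewrite /hatPi /hatPi_inv -scalemxAl -scalemxAr scalerA divff ?kappa_neq0 // scale1r mulVmx ?Omega_lim_unit. Qed.
Lemma hatPi_invK : hatPi_inv *m hatPi = 1%:M.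
Proof. by rewrite /hatPi /hatPi_inv -scalemxAl -scalemxAr scalerA mulVf ?kappa_neq0 // scale1r mulmxV ?Omega_lim_unit. Qed.

Lemma hatPi_inv_comm f : hatPi_inv *m toep_mx d T f = toep_mx d T f *m hatPi_inv.
Proof. by rewrite /hatPi_inv -scalemxAl Omega_lim_comm scalemxAr. Qed.

Lemma hatPi_comm f : hatPi *m toep_mx d T f = toep_mx d T f *m hatPi.
Proof.
by rewrite -[LHS]mulmx1 -hatPi_invK mulmxA -(mulmxA hatPi) -hatPi_inv_comm mulmxA hatPiK mul1mx.
Qed.

(** The scalar (-theta^q)^d left by [conn_lim_Omega] is absorbed by kappa^q = kappa (-theta^q)^d. *)
Lemma hatPi_conn : hatPi *m conn_lim hC d = e_d1 *m map_mx phi hatPi.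
Proof.
have VV : map_mx phi V *m map_mx phi (invmx V) = 1%:M.
  by rewrite -map_mxM mulmxV ?Omega_lim_unit // map_mx1.
rewrite -[LHS]mulmx1 -VV mulmxA -(mulmxA hatPi) conn_lim_Omega // /hatPi.
have -> : map_mx phi (kappa *: invmx V) = kappa ^+ q *: map_mx phi (invmx V).
  by rewrite map_mxZ.
rewrite -!scalemxAl -!scalemxAr -!scalemxAl scalerA -kappaE; congr (_ *: _).
by rewrite (mulmxA (invmx V)) mulVmx ?Omega_lim_unit // mul1mx.
Qed.

Definition conj_lim j := hatPi *m S j *m mx_twist q j hatPi_inv.

Lemma conj_lim0 : conj_lim 0 = 1%:M.
Proof.
rewrite /conj_lim lim_prod0 mulmx1 (_ : mx_twist q 0 hatPi_inv = hatPi_inv) ?hatPiK //.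
by apply/matrixP => i j; rewrite !mxE expn0 expr1.
Qed.

(** Coefficients in F_q are fixed by Frobenius, so twisting only moves the point. *)
Lemma mx_twist_toep j f : mx_twist q j (toep_mx d T (map_poly emb f)) = toep_mx d (nd j) (map_poly emb f).
Proof.
rewrite (mx_twist_phi iota) map_toep_mx; congr toep_mx.
rewrite -map_poly_comp; apply: eq_map_poly => c /=.
rewrite /frob /const_emb /= -!rmorphXn /=; congr (iota (_%:P%:F)).
elim: j => [|j IH]; first by rewrite expn0 expr1.
by rewrite expnSr exprM IH expf_card.
Qed.

Lemma mx_twist_jet j f : mx_twist q j (jet d T (map_poly emb f)) = jet d (nd j) (map_poly emb f).
Proof.
have e g z : jet d z g = toep_mx d z g *m jet d z 1 by rewrite -jetM mulr1.
rewrite e (mx_twistM iota) mx_twist_toep [RHS]e; congr (_ *m _).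
apply/matrixP => a b; rewrite !mxE -[1]/('X^0) nderivnXn !hornerMn !hornerXn.
case: (d - a.+1)%N => [|m]; first by rewrite bin0 subnn !expr0 expr1n.
by rewrite bin0n !mulr0n expr0n eqn0Ngt expn_gt0 (ltnW q1).
Qed.

Lemma embX : map_poly emb 'X = 'X. Proof. exact: map_polyX. Qed.

(** Conjugation turns the connecting matrix into e_(d,1), giving the functional equation of the
    exponential. *)
Lemma conj_lim_X j : conj_lim j *m toep_mx d (nd j) 'X = toep_mx d T 'X *m conj_lim j
  + (if j is i.+1 then e_d1 *m map_mx phi (conj_lim i) else 0).
Proof.
have tw : mx_twist q j hatPi_inv *m toep_mx d (nd j) 'X = toep_mx d (nd j) 'X *m mx_twist q j hatPi_inv.
  by rewrite -embX -mx_twist_toep -!(mx_twistM iota) hatPi_inv_comm.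
rewrite /conj_lim -mulmxA tw mulmxA -(mulmxA hatPi) lim_prod_X mulmxDr mulmxDl !mulmxA -hatPi_comm; congr (_ + _).
case: j {tw} => [|j]; first by rewrite mulmx0 mul0mx.
rewrite mulmxA hatPi_conn !map_mxM !mulmxA; congr (_ *m _).
by rewrite (mx_twistS iota).
Qed.

(** * The exponential, its periods and the sine *)

Section Exponential.
Variable Q : nat -> 'M[{fraction {poly F}}]_d.
Hypothesis hQ : is_exp_carlitz Q.

Lemma Q_X j : map_mx iota (Q j) *m toep_mx d (nd j) 'X = toep_mx d T 'X *m map_mx iota (Q j)
  + (if j is i.+1 then e_d1 *m map_mx phi (map_mx iota (Q i)) else 0).
Proof.
have [_ /(_ j)/(congr1 (map_mx iota))] := hQ.
have thN : map_mx iota ((theta F)%:M + Nmx F d) = toep_mx d T 'X.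
  by rewrite -toep_mxX map_toep_mx map_polyX.
have twi k (M : 'M[{fraction {poly F}}]_d) : map_mx iota (mx_twist q k M) = mx_twist q k (map_mx iota M).
  by apply/matrixP => a b; rewrite !mxE rmorphXn.
rewrite tmul_tmono0r ?(ltnW q1) //.
rewrite map_mxM twi thN -embX mx_twist_toep => ->; rewrite embX.
rewrite /tmul big_ord_recl /carlitz_theta /= /tmono /= subn0 addr0 map_mxD map_mxM thN twi.
have -> : mx_twist q 0 (map_mx iota (Q j)) = map_mx iota (Q j).
  by apply/matrixP => a b; rewrite !mxE expn0 expr1.
congr (_ + _); case: j => [|j]; first by rewrite big_ord0 map_mx0.
rewrite big_ord_recl big1 ?addr0 => [|i _]; last by rewrite /= addr0 mul0mx.
rewrite /= add0r subn1 map_mxM twi (mx_twist_phi1 iota); congr (_ *m _).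
by apply/matrixP => a b; rewrite !mxE; case: (_ && _); rewrite ?rmorph1 ?rmorph0.
Qed.

(* [exp (theta + N) = C_theta exp] determines the coefficients of exp recursively. *)
Lemma exp_conj_lim j : map_mx iota (Q j) = conj_lim j.
Proof.
elim: j => [|j IH]; first by have [-> _] := hQ; rewrite map_mx1 conj_lim0.
apply/eqP; rewrite -subr_eq0; apply/eqP.
have ne : T != nd j.+1 by rewrite -{1}nd0; apply/eqP => /(@node_T_inj F C iota).
apply: (intertwiner0 ne); rewrite mulmxBl Q_X conj_lim_X IH mulmxBr opprD addrACA subrr addr0.
by [].
Qed.

Lemma twist_hatPi_invK j n (Y : 'M[C]_(d, n)) :
  mx_twist q j hatPi_inv *m (mx_twist q j hatPi *m Y) = Y.
Proof. by rewrite mulmxA -(mx_twistM iota) hatPi_invK (mx_twist_phi iota) map_mx1 mul1mx. Qed.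

Lemma series_act_exp (Y W : 'cV[C]_d) : series_act F abs S Y W ->
  series_act F abs (series_map iota Q) (hatPi *m Y) (hatPi *m W).
Proof.
move=> h; have := mx_cvgM hC (mx_cvg_cst hC hatPi) h.
apply: (mx_cvg_eq hC) => n; rewrite mulmx_sumr; apply: eq_bigr => j _.
by rewrite /series_map exp_conj_lim /conj_lim (mx_twistM iota) -!mulmxA twist_hatPi_invK.
Qed.

Lemma series_act_exp' (Y W : 'cV[C]_d) :
  series_act F abs (series_map iota Q) (hatPi *m Y) W -> series_act F abs S Y (hatPi_inv *m W).
Proof.
move=> h; have := mx_cvgM hC (mx_cvg_cst hC hatPi_inv) h.
apply: (mx_cvg_eq hC) => n; rewrite mulmx_sumr; apply: eq_bigr => j _.
by rewrite /series_map exp_conj_lim /conj_lim (mx_twistM iota) -!mulmxA twist_hatPi_invK mulmxA hatPi_invK mul1mx.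
Qed.

Lemma prod_act_jet k f : prod_act iota k (jet d T (map_poly emb f)) = jet_fun k.+1 (P k) nd (map_poly emb f).
Proof. by apply: eq_bigr => j _; rewrite mx_twist_jet. Qed.

Lemma coef_nnode_le1 k i : abs (nnode_poly d q T 1 k)`_i <= 1.
Proof.
rewrite /nnode_poly; elim/big_rec: _ i => [|j x _ IH] i.
  by rewrite coef1; case: eqP => _; rewrite ?(abs1 hC) ?(abs0 hC).
have lf m : abs (lin_fact q T j)`_m <= 1.
  rewrite /lin_fact coefB coef1 coefZ coefX; apply: (absB_le hC).
    by case: eqP => _; rewrite ?(abs1 hC) ?(abs0 hC).
  case: eqP => _; rewrite ?mulr0 ?(abs0 hC) // mulr1 (absV hC) (abs_node hC).
  by rewrite invf_le1 ?exprn_gt0 ?(t_gt0 hC) // exprn_ege1 // ltW // (t_gt1 hC).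
have mulc (u v : {poly C}) : (forall m, abs u`_m <= 1) -> (forall m, abs v`_m <= 1) ->
    forall m, abs (u * v)`_m <= 1.
  move=> hu hv m; rewrite coefM; apply: (abs_sum_le hC) => // l _.
  by rewrite (Cinfty_absM hC) mulr_ile1 ?(Cinfty_abs_ge0 hC).
apply: (mulc) => // m; move: m; elim: {1}d => [|n IHn] m.
  by rewrite expr0 coef1; case: eqP => _; rewrite ?(abs1 hC) ?(abs0 hC).
by rewrite exprS; apply: (mulc).
Qed.

(** Comparing determinants in [mx_twist_toep] reduces the claim to a(theta) != 0. *)
Lemma emb_eval_neq0 (a : {poly F}) j : a != 0 -> (map_poly emb a).[nd j] != 0.
Proof.
move=> a0.
have aT : (map_poly emb a).[T] != 0.
  rewrite /const_emb map_poly_comp horner_map fmorph_eq0 /= map_poly_comp /theta horner_map /=.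
  by rewrite -[_.['X]]/(a \Po 'X) comp_polyXr tofrac_eq0.
have /(congr1 determinant) := mx_twist_toep j a.
rewrite (mx_twist_phi iota) det_map_mx !det_toep_mx => e.
apply: contra_neq aT => z; move: e; rewrite z expr0n eqn0Ngt d0 /= => /eqP.
by rewrite fmorph_eq0 expf_eq0 d0 => /eqP.
Qed.

(* If a is not constant, the jets of c / a (deg c < deg a) are not all killed by S:
   reducing W_k modulo a would write P_k(W_k / a), whose last
   entry has absolute value |1 / a(theta)|, as a combination of the
   P_k(x^i / a) with coefficients of absolute value at most 1. *)
Lemma jets_over_nonconst (a : {poly F}) : (1 < size a)%N ->
  ~ forall i, mx_cvg abs (fun k => prod_act iota k (invmx (toep_mx d T (map_poly emb a)) *m jet d T 'X^i)) 0.
Proof.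
move=> sa hcv; set A := map_poly emb a in hcv.
have a0 : a != 0 by rewrite -size_poly_gt0 (ltn_trans _ sa).
have A0 : A != 0 by rewrite map_poly_eq0.
have sA : size A = size a by apply: size_map_poly.
have An j : A.[nd j] != 0 by apply: emb_eval_neq0.
(* [jet_fun] with these coefficients is the functional sending g to P_k(g / a). *)
pose Pa k j := P k j *m invmx (toep_mx d (nd j) A).
pose W k := nnode_poly d q T 1 k.+1.
have PX k i : prod_act iota k (invmx (toep_mx d T A) *m jet d T 'X^i) = jet_fun k.+1 (Pa k) nd 'X^i.
  apply: eq_bigr => j _; rewrite (mx_twistM iota) mulmxA; congr (_ *m _ *m _).
    rewrite !(mx_twist_phi iota) map_invmx; congr invmx.
    by rewrite -(mx_twist_phi iota) mx_twist_toep.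
  by rewrite -(map_polyXn emb) mx_twist_jet map_polyXn.
have RA k g : jet_fun k.+1 (Pa k) nd (A * g) = jet_fun k.+1 (P k) nd g.
  apply: eq_bigr => j _; rewrite jetM /Pa -mulmxA [invmx _ *m _]mulmxA.
  by rewrite mulVmx ?mul1mx // toep_mx_unit.
have RW k : jet_fun k.+1 (Pa k) nd (W k) = invmx (toep_mx d T A) *m jet d T (W k).
  rewrite /jet_fun big_ord_recl /Pa twisted_prod0 mul1mx nd0 big1 ?addr0 // => j _.
  have := node_polyE d q T0 1 k.+1; rewrite -/(W k) => e.
  have : jet d (nd (lift ord0 j)) (node_poly d q T 1 k.+1 * 1) = 0.
    by apply: jet_node_poly; rewrite /= /bump /=; have := ltn_ord j; lia.
  rewrite mulr1 e jetZ => /eqP; rewrite scaler_eq0 (negPf (prod_node_neq0 d q T0 _ _)) /=.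
  by move=> /eqP ->; rewrite mulmx0.
have sW k : (size (W k) <= (d * k).+1)%N.
  have := size_node_poly d q T 1 k.+1; rewrite (node_polyE d q T0) size_scale ?prod_node_neq0 //.
  by rewrite subn1 => ->.
(* As a is not constant, the quotient of W_k by a has degree below dk and is killed by P_k. *)
have RWmod k : invmx (toep_mx d T A) *m jet d T (W k)
    = \sum_(i < (size a).-1) (W k %% A)`_i *: jet_fun k.+1 (Pa k) nd 'X^i.
  rewrite -RW {1}(divp_eq (W k) A) jet_funD [_ * A]mulrC RA prod_kills ?add0r.
    have sr : (size (W k %% A)%R <= (size a).-1)%N.
      by have := ltn_modp (W k) A; rewrite A0 sA; move: sa (size _) => /=; lia.
    rewrite {1}(_ : W k %% A = \sum_(i < (size a).-1) (W k %% A)`_i *: 'X^i); last first.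
      rewrite -poly_def; apply/polyP => i; rewrite coef_poly; case: ltnP => // h.
      by rewrite nth_default // (leq_trans sr).
    by rewrite jet_fun_sum; apply: eq_bigr => i _; rewrite jet_funZ.
  by rewrite size_divp // sA; have := sW k; move: (size (W k)) => s; lia.
(* The remainders of monomials modulo a have coefficients in F_q, and those of W_k are bounded by
   1. *)
have modle k i : abs (W k %% A)`_i <= 1.
  rewrite -[W k]coefK poly_def (big_morph (fun p => p %% A) (@modpD _ A) (mod0p A)) coef_sum.
  apply: (abs_sum_le hC) => // m _; rewrite modpZl coefZ (Cinfty_absM hC) mulr_ile1 ?(Cinfty_abs_ge0 hC) //.
    exact: coef_nnode_le1.
  rewrite -(map_polyXn emb) -map_modp coef_map /=; exact: (abs_const_le1 hC).
have cv0 : mx_cvg abs (fun k => invmx (toep_mx d T A) *m jet d T (W k)) 0.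
  move=> i c; rewrite mxE.
  have h (m : 'I_(size a).-1) : abs_cvg abs (fun k => jet_fun k.+1 (Pa k) nd 'X^m i c * (W k %% A)`_m) 0.
    apply: (abs_cvg0_bounded hC (B := 1)) => [|k]; last exact: modle.
    by have := hcv m i c; rewrite mxE; apply: (abs_cvg_eq hC) => k; rewrite PX.
  have := abs_cvg_sum hC (index_enum _) (P := xpredT) (fun m _ => h m).
  rewrite big1 //; apply: (abs_cvg_eq hC) => k.
  by rewrite RWmod summxE; apply: eq_bigr => m _; rewrite mxE mulrC.
have := mx_cvgM hC (mx_cvg_cst hC (toep_mx d T A)) cv0.
have lt_d : (d.-1 < d)%N by rewrite prednK.
move=> /(_ (Ordinal lt_d) 0); rewrite mulmx0 mxE => h.
(* The last entry of the jet of W_k is W_k(theta), of absolute value 1, yet it tends to 0. *)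
have : abs 0 = 1.
  apply: (abs_cvg_norm hC ltr01 _ h) => k.
  rewrite mulmxA mulmxV ?mul1mx ?mxE /=; last by rewrite -nd0; apply: toep_mx_unit.
  rewrite prednK // subnn nderivn0; apply: (abs_nnode_poly hC).
  by apply: (nodes_gt hC); rewrite nd0.
by rewrite (abs0 hC) => /eqP; rewrite eq_sym oner_eq0.
Qed.

Variable Pi : 'cV[C]_d.
Hypothesis hPi : is_period iota abs Q Pi.

Lemma map_poly_at a : map_mx iota (poly_at_thetaN d a) = toep_mx d T (map_poly emb a).
Proof.
by rewrite poly_at_thetaN_toep map_toep_mx -map_poly_comp.
Qed.

(** The last column of [hatPi] is in the kernel of exp, hence equals a(theta + N) Pi for some a in
    A; the claim is that a is constant. *)
Lemma hatPi_period : exists2 c : F, c != 0 & hatPi = emb c *: period_mx Pi.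
Proof.
have [Pi0 ker] := hPi.
have J1 : jet d T 1 = jet d T (map_poly emb 1) by rewrite rmorph1.
have S1 : series_act F abs S (jet d T 1) 0.
  (* P_k kills constants only once dk >= 1, hence the shift past k = 0. *)
  apply/(prod_act_series hC); apply/(mx_cvg_shift hC _ _ 1).
  apply: (mx_cvg_eq hC) (mx_cvg_cst hC 0) => k.
  rewrite J1 prod_act_jet addn1 rmorph1 prod_kills // size_poly1.
  by rewrite muln_gt0 d0.
have := series_act_exp S1; rewrite mulmx0 => /ker[a]; rewrite map_poly_at => ha.
have jet1 : jet d T 1 != 0 :> 'cV[C]_d.
  have lt_d : (d.-1 < d)%N by rewrite prednK.
  apply/eqP => /matrixP/(_ (Ordinal lt_d) 0); rewrite !mxE /= prednK // subnn nderivn0 hornerC.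
  by apply/eqP/oner_neq0.
have a0 : a != 0.
  apply: contraTneq (introT eqP ha) => ->; rewrite rmorph0 -(scale0r 0) toep_mxZ scale0r mul0mx.
  by apply: contra jet1 => /eqP e; rewrite -(mul1mx (jet _ _ _)) -hatPi_invK -mulmxA e mulmx0.
set A := toep_mx d T (map_poly emb a) in ha.
have uA : A \in unitmx by apply: toep_mx_unit; rewrite -nd0; apply: emb_eval_neq0.
have iA (M : 'M[C]_d) : M *m A = A *m M -> M *m invmx A = invmx A *m M.
  by move=> e; rewrite -[LHS](mulKmx uA) [A *m (_ *m _)]mulmxA -e mulmxK.
have [sa|sa] := ltnP 1 (size a).
  (* Every theta^i-multiple of Pi = a(theta + N)^-1 [hatPi] J(1) is in the kernel of exp, so S would
     vanish on the jets of all x^i / a. *)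
  exfalso; apply: (jets_over_nonconst sa) => i.
  apply/(prod_act_series hC); rewrite -/A.
  have : series_act F abs (series_map iota Q) (toep_mx d T (map_poly emb 'X^i) *m Pi) 0.
    by apply/ker; exists 'X^i; rewrite map_poly_at.
  rewrite -[Pi](mulKmx uA) -ha map_polyXn.
  have -> : toep_mx d T 'X^i *m (invmx A *m (hatPi *m jet d T 1))
    = hatPi *m (invmx A *m jet d T 'X^i).
    have -> : jet d T 'X^i = toep_mx d T 'X^i *m jet d T 1 by rewrite -jetM mulr1.
    have e1 : toep_mx d T 'X^i *m invmx A = invmx A *m toep_mx d T 'X^i.
      by apply: iA; exact: toep_mxCM.
    have e2 : hatPi *m invmx A = invmx A *m hatPi by apply: iA; exact: hatPi_comm.
    by rewrite !mulmxA e1 e2 -(mulmxA (invmx A) _ hatPi) -hatPi_comm mulmxA.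
  by move/series_act_exp'; rewrite mulmx0.
have := size1_polyC sa; set c := a`_0 => ac; exists c.
  by apply: contra_neq a0 => c0; rewrite ac c0 polyC0.
rewrite -period_mxZ -(period_mx_comm (hatPi_comm 'X)) ha /A ac map_polyC toep_mxC.
by rewrite mul_scalar_mx.
Qed.

(** The constant relating [hatPi] and [period_mx Pi] is fixed by Frobenius, so it cancels in the
    conjugation. *)
Lemma sinAE j : sinA iota Q Pi j = S j.
Proof.
have [c c0 PE] := hatPi_period; have ec : emb c != 0 by rewrite fmorph_eq0.
have P'E : period_mx Pi = (emb c)^-1 *: hatPi by rewrite PE scalerA mulVf // scale1r.
have iP : invmx (period_mx Pi) = emb c *: hatPi_inv.
  have e : period_mx Pi *m (emb c *: hatPi_inv) = 1%:M.
    by rewrite P'E -scalemxAl -scalemxAr scalerA mulVf // scale1r hatPiK.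
  have [uP _] := mulmx1_unit e.
  by rewrite -[invmx _]mulmx1 -e mulKmx.
have twc : mx_twist q j (period_mx Pi) = (emb c)^-1 *: mx_twist q j hatPi.
  rewrite P'E (mx_twist_phi iota) map_mxZ; congr (_ *: _).
  have := mx_twist_toep j (c^-1)%:P; rewrite map_polyC /= fmorphV !toep_mxC.
  rewrite (mx_twist_phi iota) map_scalar_mx => /matrixP/(_ (Ordinal d0) (Ordinal d0)).
  by rewrite !mxE eqxx !mulr1n.
rewrite /sinA tmul_tmono0r ?(ltnW q1) // tmul_tmono0l iP /series_map exp_conj_lim twc.
rewrite -scalemxAl -scalemxAr -scalemxAl scalerA mulVf // scale1r.
by rewrite /conj_lim -!mulmxA -[mx_twist q j hatPi]mulmx1 twist_hatPi_invK mulmx1 mulmxA hatPi_invK mul1mx.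
Qed.

End Exponential.
End Main.

Theorem theoremA (F : finFieldType) (R : realType) (C : fieldType)
    (iota : {rmorphism {fraction {poly F}} -> C}) (abs : C -> R)
    (hC : is_Cinfty iota abs)
    (d : nat) (hd : (0 < d)%N)
    (Q : nat -> 'M[{fraction {poly F}}]_d) (hQ : is_exp_carlitz Q)
    (Pi : 'cV[C]_d) (hPi : is_period iota abs Q Pi) :
  exists S : nat -> 'M[C]_d,
    [/\ forall (j : nat) (r s : 'I_d), in_Kinfty iota abs (S j r s),
        forall j : nat,
          mx_cvg abs (fun k => series_map iota (partial_prod F d k) j) (S j)
      & forall j : nat, sinA iota Q Pi j = S j].
Proof.
exists (lim_prod hC d); split=> j; first exact: lim_prod_Kinfty.
  apply: (mx_cvg_eq hC) (@lim_prod_cvg _ _ _ _ _ hC d j) => k.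
  by rewrite series_partial_prod.
exact: (sinAE hC hd hQ hPi).
Qed.
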